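(* Fix $N$. (i) There is a coupling of diffusive deposition $(\sigma(t))_{t\ge0}$ and Pólya's urn $(\eta(t))_{t\ge0}$ with $N$ colours, both started from $(0,\dots,0)$, such that $\sigma(t)\succ\eta(t)$ for all $t\ge0$; the same holds with ballistic deposition in place of diffusive deposition. (ii) There is a coupling of Pólya's urn $(\eta(t))$ and random allocation $(\xi(t))$ with $N$ colours, both started from $(0,\dots,0)$, such that $\eta(t)\succ\xi(t)$ for all $t\ge0$. That is, both deposition models are more monopolistic than Pólya's urn, which is more monopolistic than random allocation.
   Context: Deposition models: for $N\ge2$, $G_N=\{1,\dots,N\}$, a configuration $\sigma\in\mathbb N^N$ gives column heights; given $\sigma$, an explorer is a walk $(X_n,Z_n)_{n\ge0}$ with $(X_n)$ i.i.d. uniform on $G_N$, $Z_0=\max_i\sigma_i+1$, and increments $Z_{n+1}-Z_n$ i.i.d. uniform on $\{-1,1\}$ (diffusive deposition) or identically $-1$ (ballistic deposition); with $n^*=\inf\{n:Z_n\le\sigma_{X_n}\}$, the configuration becomes $\sigma+e_{X_{n^*}}$. Explorers are sent successively and independently; $\sigma(t)$ is the configuration after $t$ explorers. Pólya's urn with $N$ colours: a process $\eta(t)\in\mathbb N^N$ which at each step increases coordinate $i$ by one with probability $(\eta_i+1)/(|\eta|+N)$, where $|\eta|=\sum_j\eta_j$. Random allocation: at each step a coordinate chosen uniformly in $G_N$ is increased by one. Order: for $\sigma\in\mathbb N^N$ let $\bar\sigma$ be its nonincreasing rearrangement. For $\sigma,\eta\in\mathbb N^N$ with $|\sigma|=|\eta|$,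 write $\sigma\succ\eta$ (equivalently $\eta\prec\sigma$; ''$\sigma$ is more monopolistic than $\eta$'') if $\sum_{i=1}^k\bar\sigma_i\ge\sum_{i=1}^k\bar\eta_i$ for every $k=1,\dots,N$. *)

(* Defs.v *)
From Stdlib Require Import Reals ZArith List Sorted Permutation Arith.
Import ListNotations.
Open Scope R_scope.

Record ProbSpace := {
  Omega : Type;
  meas : (Omega -> Prop) -> Prop;
  Pr : (Omega -> Prop) -> R;
  meas_full : meas (fun _ => True);
  meas_compl : forall A, meas A -> meas (fun w => ~ A w);
  meas_cunion : forall A : nat -> Omega -> Prop,
      (forall n, meas (A n)) -> meas (fun w => exists n, A n w);
  Pr_nonneg : forall A, meas A -> 0 <= Pr A;
  Pr_full : Pr (fun _ => True) = 1;
  Pr_cadd : forall A : nat -> Omega -> Prop,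
      (forall n, meas (A n)) ->
      (forall n m w, n <> m -> A n w -> A m w -> False) ->
      infinite_sum (fun n => Pr (A n)) (Pr (fun w => exists n, A n w))
}.

(** Configurations: lists of length N; column j has height [nth j c 0]. *)
Definition config := list nat.
Definition height (c : config) (j : nat) : nat := nth j c 0%nat.
Definition size (c : config) : nat := fold_right Nat.add 0%nat c.
Definition maxh (c : config) : nat := fold_right Nat.max 0%nat c.

Fixpoint incr (c : config) (i : nat) : config :=
  match c, i with
  | [], _ => []
  | x :: c', O => S x :: c'
  | x :: c', S i' => x :: incr c' i'
  end.

Definition process (ps : ProbSpace) := nat -> Omega ps -> config.

Definition measurable_process {ps : ProbSpace} (X : process ps) : Prop :=
  forall t c, meas ps (fun w => X t w = c).

Definition path_event {ps : ProbSpace} (X : process ps) (path : list config)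
  : Omega ps -> Prop :=
  fun w => forall t, (t < length path)%nat -> X t w = nth t path [].

(** Transition kernels given relationally: [K c c' p] means
    "the probability to go from c to c' is p". *)
Definition kernel := config -> config -> R -> Prop.

(** X is a Markov chain started at x0 with kernel K (law fixed through all
    finite-dimensional distributions). *)
Definition markov_chain {ps : ProbSpace} (X : process ps) (x0 : config)
  (K : kernel) : Prop :=
  Pr ps (fun w => X 0%nat w = x0) = 1 /\
  forall (path : list config) (c c' : config) (p : R),
    K (last (c :: path) c) c' p ->
    Pr ps (path_event X ((c :: path) ++ [c'])) =
      Pr ps (path_event X (c :: path)) * p.

Definition add_kernel (N : nat) (prob : config -> nat -> R -> Prop) : kernel :=
  fun c c' p =>
    (exists i, (i < N)%nat /\ c' = incr c i /\ prob c i p) \/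
    ((forall i, (i < N)%nat -> c' <> incr c i) /\ p = 0).

Definition polya_kernel (N : nat) : kernel :=
  add_kernel N (fun c i q =>
    q = (INR (height c i) + 1) / (INR (size c) + INR N)).

Definition alloc_kernel (N : nat) : kernel :=
  add_kernel N (fun _ _ q => q = / INR N).

Fixpoint words {A : Type} (al : list A) (n : nat) : list (list A) :=
  match n with
  | O => [[]]
  | S n' => flat_map (fun w => map (fun a => a :: w) al) (words al n')
  end.

(** Given columns X_0..X_n (xs) and increments d_0..d_{n-1} (ss, with
    weights), starting at height z = Z_0: does the explorer continue above
    the configuration at times 0..n-1 and stop at time n (Z_n <= c_{X_n})
    with X_n = i ? *)
Fixpoint stops_at (c : config) (i : nat) (z : Z) (xs : list nat)
  (ss : list (Z * R)) : bool :=
  match xs, ss with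
  | [x], [] => Z.leb z (Z.of_nat (height c x)) && Nat.eqb x i
  | x :: xs', (d, _) :: ss' =>
      Z.ltb (Z.of_nat (height c x)) z && stops_at c i (z + d)%Z xs' ss'
  | _, _ => false
  end.

Definition sumR (l : list R) : R := fold_right Rplus 0 l.
Definition prodR (l : list R) : R := fold_right Rmult 1 l.

(** P(n* = n and X_{n*} = i), for an explorer with i.i.d. increments drawn
    from [steps] (value, probability), X uniform on {0..N-1}. *)
Definition stop_term (N : nat) (steps : list (Z * R)) (c : config) (i : nat)
  (n : nat) : R :=
  sumR (flat_map (fun xs =>
    map (fun ss =>
      if stops_at c i (Z.of_nat (maxh c) + 1)%Z xs ss
      then (/ INR N) ^ (S n) * prodR (map snd ss) else 0)
      (words steps n))
    (words (seq 0 N) (S n))).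

Definition land_prob (N : nat) (steps : list (Z * R)) (c : config) (i : nat)
  (q : R) : Prop :=
  infinite_sum (stop_term N steps c i) q.

Definition diffusive_steps : list (Z * R) := [(1%Z, / 2); ((-1)%Z, / 2)].
Definition ballistic_steps : list (Z * R) := [((-1)%Z, 1)].

Definition diffusive_kernel (N : nat) : kernel :=
  add_kernel N (land_prob N diffusive_steps).
Definition ballistic_kernel (N : nat) : kernel :=
  add_kernel N (land_prob N ballistic_steps).

Definition dec_rearr (r s : list nat) : Prop :=
  Permutation r s /\ Sorted ge r.

Definition more_mono (N : nat) (s t : config) : Prop :=
  size s = size t /\
  forall rs rt, dec_rearr rs s -> dec_rearr rt t ->
    forall k, (1 <= k <= N)%nat ->
      (fold_right Nat.add 0%nat (firstn k rt) <=
       fold_right Nat.add 0%nat (firstn k rs))%nat.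

Definition dominating_coupling (N : nat) (K1 K2 : kernel) : Prop :=
  exists (ps : ProbSpace) (X Y : process ps),
    measurable_process X /\ measurable_process Y /\
    markov_chain X (repeat 0%nat N) K1 /\
    markov_chain Y (repeat 0%nat N) K2 /\
    exists A, meas ps A /\ Pr ps A = 1 /\
      forall w, A w -> forall t, more_mono N (X t w) (Y t w).

(* Main.v *)
Require Import Defs.
From Stdlib Require Import Reals ZArith List Sorted Permutation Arith.
From Stdlib Require Import Lra Lia Classical IndefiniteDescription.
From Stdlib Require Import FunctionalExtensionality PropExtensionality.
From mathcomp Require all_boot all_order all_algebra.
From mathcomp Require boolp classical_sets reals ereal Rstruct Rstruct_topology.
From mathcomp Require interval_inference topology normedtype sequences measure.
From mathcomp Require lebesgue_measure lebesgue_stieltjes_measure measurable_realfun.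

(** Rank the columns of both configurations by decreasing height, and let the columns of
    rank [k] in the first one and [l] in the second one grow according to the quantile
    coupling of the two laws on ranks. If the first law always gives at least as much mass
    to the top ranks, then [k <= l], and growing a column of better rank preserves the
    order.

    For the urns the mass of the top ranks is compared directly. For a deposition model,
    the probability to land on column [i] is proportional to the sum over heights
    [0 <= y <= h_i] of the expected number of visits of the explorer to height [y] before
    it stops. Below the starting height this Green function is nondecreasing in [y], so
    the landing probability divided by [h_i + 1] increases with [h_i], whereas it is
    constant for Polya's urn.

    Both processes live on [0,1) with Lebesgue measure: a uniform variable is located in
    a partition given by the transition probabilities, and its rescaled position in the
    selected interval drives the next step. *)

(** * Lebesgue measure on the unit interval *)

(** As [a, a + w) lies in [0,1), the preimage of [0,1) under the rescaling is exactly that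
    interval. *)
Lemma affine_unit_interval (a w u : R) : 0 < w -> 0 <= a -> a + w <= 1 ->
  (0 <= (u - a) / w /\ (u - a) / w < 1) <->
  ((a <= u /\ u < a + w) /\ (0 <= u /\ u < 1)).
Proof.
intros Hw Ha Haw.
assert (E : u - a = w * ((u - a) / w)) by (field; lra).
split.
- intros [H0 H1].
  assert (0 <= w * ((u - a) / w)) by (apply Rmult_le_pos; lra).
  assert (w * ((u - a) / w) < w * 1) by (apply Rmult_lt_compat_l; lra).
  lra.
- intros [[H0 H1] _]; split.
  + apply Rmult_le_pos; [lra | apply Rlt_le, Rinv_0_lt_compat; lra].
  + apply (Rmult_lt_reg_l w); lra.
Qed.

Module UnitInterval.
Import all_boot all_order all_algebra.
Import boolp classical_sets reals ereal Rstruct Rstruct_topology.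
Import interval_inference topology normedtype sequences measure lebesgue_measure.
Import lebesgue_stieltjes_measure measurable_realfun.
Import Order.TTheory GRing.Theory Num.Theory.
Import numFieldNormedType.Exports.
Local Open Scope classical_set_scope.
Local Open Scope ring_scope.

Notation T := (measurableTypeR R).
Notation lam := (@lebesgue_measure R).
Notation I01 := (`[0%R, 1%R[%classic : set T).

Lemma measurable_affine (a b : R) :
  measurable_fun [set: T] (fun u : T => a * u + b : T).
Proof.
apply: measurable_funD; last exact: measurable_cst.
by apply: measurable_funM; [exact: measurable_cst|exact: measurable_id].
Qed.

(** The image of Lebesgue measure under the affine map, multiplied by [w^-1], agrees with Lebesgue
    measure on half-open intervals, hence on all measurable sets by uniqueness. *)
Lemma lam_affine (w a : R) (B : set T) : 0 < w -> measurable B ->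
  lam ((fun u : T => w^-1 * u + (- a / w) : T) @^-1` B) = (w%:E * lam B)%E.
Proof.
move=> w0 mB.
have w0' : 0 <= w^-1 by rewrite invr_ge0 ltW.
pose f : T -> T := fun u => w^-1 * u + (- a / w).
have mf : measurable_fun [set: T] f by exact: measurable_affine.
have [nu nuE] : exists nu : {measure set T -> \bar R},
    forall A, nu A = ((w^-1)%:E * lam (f @^-1` A))%E.
  by unshelve eexists (mscale (NngNum w0') (pushforward lam f)).
suff H : lam B = nu B.
  rewrite H nuE muleA -EFinM.
  by rewrite mulfV ?mul1e// gt_eqF.
apply: lebesgue_measure_unique mB => X /ocitvP[->|[[x y] /= xy ->]].
  by rewrite !measure0.
rewrite nuE.
have -> : f @^-1` `]x, y] = `]a + w * x, a + w * y]%classic.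
  have fE u : w * f u = u - a.
    by rewrite /f mulrDr mulVKf ?gt_eqF// [w * (_ / _)]mulrC divfK ?gt_eqF.
  apply/seteqP; split => u; rewrite /preimage /= !in_itv /=
    -[x < _](ltr_pM2l w0) -[_ <= y](ler_pM2l w0) fE;
    by rewrite ltrBrDl lerBlDl.
rewrite !lebesgue_measure_itv /= !lte_fin xy ltrD2l ltr_pM2l// xy.
rewrite -!EFinD -EFinM; congr (_%:E).
rewrite opprD addrACA subrr add0r -mulrBr mulKf// gt_eqF//.
Qed.

Lemma lam_fin (A : set T) : measurable A -> lam (A `&` I01) \is a fin_num.
Proof.
move=> mA; rewrite ge0_fin_numE//.
apply: (@le_lt_trans _ _ (lam I01)).
  by apply: le_measure; rewrite ?inE//; apply: measurableI.
by rewrite lebesgue_measure_itv /= lte_fin ltr01 -EFinD ltry.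
Qed.

(** The sample space is the whole line with all mass on [0,1): affine maps stay total and only
    [Pr01] sees the interval. *)
Definition meas01 (A : R -> Prop) : Prop := measurable (A : set T).
Definition Pr01 (A : R -> Prop) : R := fine (lam ((A : set T) `&` I01)).

Lemma meas01_full : meas01 (fun _ => True).
Proof. exact: measurableT. Qed.

Lemma meas01_compl A : meas01 A -> meas01 (fun w => ~ A w).
Proof. exact: measurableC. Qed.

Lemma meas01_cunion (A : nat -> R -> Prop) :
  (forall n, meas01 (A n)) -> meas01 (fun w => exists n, A n w).
Proof.
move=> mA; have -> : (fun w => exists n, A n w) = \bigcup_n (A n : set T).
  by apply/seteqP; split => [x [n An]|x [n _ An]]; exists n.
by rewrite /meas01; apply: bigcup_measurable => k _; exact: mA.
Qed.

Lemma Pr01_nonneg A : meas01 A -> Rle 0%R (Pr01 A).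
Proof. by move=> mA; apply/RleP; exact: fine_ge0. Qed.

Lemma Pr01_full : Pr01 (fun _ => True) = 1.
Proof.
rewrite /Pr01 [X in lam X](_ : _ = I01) ?lebesgue_measure_itv /= ?lte_fin ?ltr01.
  by rewrite -EFinD /= subr0.
by apply/seteqP; split => [x []//|x].
Qed.

Lemma Pr01_cadd (A : nat -> R -> Prop) :
  (forall n, meas01 (A n)) ->
  (forall n m w, n <> m -> A n w -> A m w -> False) ->
  infinite_sum (fun n => Pr01 (A n)) (Pr01 (fun w => exists n, A n w)).
Proof.
move=> mA dA.
pose B n : set T := (A n : set T) `&` I01.
have mB n : measurable (B n) by apply: measurableI => //; exact: mA.
have -> : Pr01 (fun w => exists n, A n w) = fine (lam (\bigcup_n B n)).
  rewrite /Pr01; congr (fine (lam _)); apply/seteqP; split.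
    by move=> x [[n An] xI]; exists n.
  by move=> x [n _ [An xI]]; split => //; exists n.
have tB : trivIset setT B.
  apply/trivIsetP => i j _ _ /eqP ij; apply/seteqP; split => // x [[Ai _] [Aj _]].
  exact: (dA i j x).
have mU : measurable (\bigcup_n B n) by exact: bigcup_measurable.
have fU : lam (\bigcup_n B n) \is a fin_num.
  by rewrite -setI_bigcupl; apply: lam_fin; apply: bigcup_measurable => k _; exact: mA.
have : (\sum_(0 <= i < n) lam (B i))%E @[n --> \oo] --> lam (\bigcup_n B n).
  exact: measure_semi_sigma_additive.
rewrite -{1}(fineK fU).
move=> /fine_cvgP[_ /cvgrPdist_lt cv] eps /RltP eps0.
have [M _ HM] := cv _ eps0.
exists M => n nM; apply/RltP.
(* [sum_f_R0] up to [n] has [n + 1] terms. *)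
have := HM n.+1 => /(_ _) /=.
rewrite sum_f_R0E RdistE distrC /=.
rewrite (_ : \sum_(0 <= k < n.+1) Pr01 (A k) = fine (\sum_(0 <= i < n.+1) lam (B i))).
  by apply; apply: leqW; apply/ssrnat.leP.
rewrite -[RHS]/(fine _) -sum_fine // => i _; exact: lam_fin (mA i).
Qed.

Definition unit_space : ProbSpace := {|
  Omega := R; meas := meas01; Pr := Pr01;
  meas_full := meas01_full; meas_compl := meas01_compl;
  meas_cunion := meas01_cunion; Pr_nonneg := Pr01_nonneg;
  Pr_full := Pr01_full; Pr_cadd := Pr01_cadd |}.

Lemma meas01_le (a : R) : meas01 (fun u => Rle a u).
Proof.
rewrite /meas01 (_ : (fun u => Rle a u) = `[a, +oo[%classic :> set T).
  exact: measurable_itv.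
by apply/seteqP; split => u /=; rewrite in_itv /= andbT => /RleP.
Qed.

Lemma meas01_affine (a b : R) (A : R -> Prop) :
  meas01 A -> meas01 (fun u => A (Rplus (Rmult a u) b)).
Proof.
by move=> mA; rewrite /meas01 -[X in measurable X]setTI; exact: measurable_affine.
Qed.

Lemma itv01E (u : R) : (Rle (IZR 0) u /\ Rlt u (IZR 1)) = (u \in `[0%R, 1%R[).
Proof.
rewrite in_itv; apply/propext; split => [[/RleP h0 /RltP h1]|/andP[/RleP h0 /RltP h1]] //.
by apply/andP.
Qed.

Lemma Pr01_unit : Pr01 (fun u => Rle (IZR 0) u /\ Rlt u (IZR 1)) = (IZR 1).
Proof.
rewrite /Pr01 [X in lam X](_ : _ = I01) ?lebesgue_measure_itv /= ?lte_fin ?ltr01.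
  by rewrite -EFinD /= subr0.
by apply/seteqP; split => [x []//|x xI]; split => //; rewrite itv01E.
Qed.

Lemma Pr01_restrict (A : R -> Prop) :
  Pr01 (fun u => (Rle (IZR 0) u /\ Rlt u (IZR 1)) /\ A u) = Pr01 A.
Proof.
congr (fine (lam _)); apply/seteqP; split => [u [[_ Au] u01]|u [Au u01]]; split => //.
by split => //; rewrite itv01E.
Qed.

(** Conditioned on [a, a + w), the rescaled variable is again uniform; this is why one uniform
    variable can drive infinitely many steps. *)
Lemma Pr01_affine (w a : R) (B : R -> Prop) :
  Rlt (IZR 0) w -> Rle (IZR 0) a -> Rle (Rplus a w) (IZR 1) -> meas01 B ->
  Pr01 (fun u => (Rle a u /\ Rlt u (Rplus a w)) /\ B (Rdiv (Rminus u a) w))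
    = Rmult w (Pr01 B).
Proof.
move=> w0 a0 aw1 mB; rewrite /Pr01.
rewrite -[Rmult _ _]/(fine (w%:E) * fine _) -fineM//; last exact: lam_fin.
rewrite -(@lam_affine w a) //; [|exact/RltP|exact: measurableI].
have -> : (fun u : T => w^-1 * u + - a / w : T) = (fun u => Rdiv (Rminus u a) w).
  by apply/funext => u; rewrite RdivE RminusE mulrC -mulrDl.
congr (fine (lam _)); apply/seteqP; split => u /=; rewrite -!itv01E => -[].
  by move=> [au Bu] u01; split=> //; apply/affine_unit_interval.
by move=> Bu /affine_unit_interval[].
Qed.
End UnitInterval.

(** * Markov chains driven by one uniform variable *)

Import ListNotations.

(** Events are bare predicates, so equivalent events are turned into equal ones before [meas] and
    [Pr] are transported. *)
Lemma pred_ext {A : Type} (P Q : A -> Prop) : (forall x, P x <-> Q x) -> P = Q.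
Proof.
  intros H; apply functional_extensionality; intros x.
  apply propositional_extensionality, H.
Qed.

Lemma meas_ext (ps : ProbSpace) (A B : Omega ps -> Prop) :
  (forall w, A w <-> B w) -> meas ps B -> meas ps A.
Proof. intros H; rewrite (pred_ext A B H); auto. Qed.

Lemma Pr_ext (ps : ProbSpace) (A B : Omega ps -> Prop) :
  (forall w, A w <-> B w) -> Pr ps A = Pr ps B.
Proof. intros H; rewrite (pred_ext A B H); auto. Qed.

Lemma sumR_map_ext {A : Type} (f g : A -> R) (l : list A) :
  (forall a, In a l -> f a = g a) -> sumR (map f l) = sumR (map g l).
Proof. intros H; f_equal; apply map_ext_in, H. Qed.

(** Countable additivity for a sequence of empty events makes [c + c + ...] converge to [c], which
    forces [c = 0]. *)
Lemma Pr_empty (ps : ProbSpace) : Pr ps (fun _ => False) = 0.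
Proof.
  assert (M : meas ps (fun _ => False)).
  { rewrite (pred_ext (fun _ => False) (fun _ : Omega ps => ~ True)) by tauto.
    apply (meas_compl ps), meas_full. }
  pose proof (Pr_nonneg ps _ M) as H0.
  pose proof (Pr_cadd ps (fun _ _ => False) (fun _ => M) (fun _ _ _ _ F _ => F)) as S.
  cbv beta in S.
  rewrite (pred_ext (fun _ => exists _ : nat, False) (fun _ : Omega ps => False)) in S
    by (intros; split; [intros [_ []] | tauto]).
  set (c := Pr ps (fun _ => False)) in *.
  destruct (Rle_lt_or_eq_dec _ _ H0) as [Hc|]; [|easy].
  destruct (S c Hc) as [n Hn].
  (* For the tolerance [c], the partial sum of index [n + 1] is off by [(n + 1) c], which is too
     much. *)
  specialize (Hn (n + 1)%nat ltac:(lia)).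
  rewrite sum_cte in Hn; unfold Rdist in Hn.
  replace (c * INR (Datatypes.S (n + 1)) - c) with (c * INR (n + 1)) in Hn
    by (rewrite S_INR; ring).
  rewrite Rabs_right in Hn by (apply Rle_ge, Rmult_le_pos; [lra | apply pos_INR]).
  rewrite plus_INR in Hn; simpl in Hn.
  pose proof (pos_INR n); nra.
Qed.

Lemma Pr_never (ps : ProbSpace) (A : Omega ps -> Prop) :
  (forall w, ~ A w) -> Pr ps A = 0.
Proof. intros H; rewrite <- (Pr_empty ps); apply Pr_ext; intros w; split; [apply H | easy]. Qed.

Lemma meas_const (ps : ProbSpace) (P : Prop) : meas ps (fun _ => P).
Proof.
  destruct (classic P) as [H | H].
  - rewrite (pred_ext (fun _ => P) (fun _ : Omega ps => True)) by tauto.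
    apply meas_full.
  - rewrite (pred_ext (fun _ => P) (fun _ : Omega ps => ~ True)) by tauto.
    apply (meas_compl ps), meas_full.
Qed.

Lemma meas_or (ps : ProbSpace) A B :
  meas ps A -> meas ps B -> meas ps (fun w => A w \/ B w).
Proof.
  intros HA HB.
  rewrite (pred_ext _ (fun w => exists n : nat, (if n then A else B) w)).
  - apply meas_cunion; intros [|]; assumption.
  - intros w; split; [intros [|]; [exists 0%nat | exists 1%nat] | intros [[|] ?]]; auto.
Qed.

Lemma meas_and (ps : ProbSpace) A B :
  meas ps A -> meas ps B -> meas ps (fun w => A w /\ B w).
Proof.
  intros HA HB.
  rewrite (pred_ext _ (fun w => ~ (~ A w \/ ~ B w))) by (intros; tauto).
  apply (meas_compl ps), meas_or; apply (meas_compl ps); assumption.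
Qed.

(** Finite additivity is countable additivity for a sequence padded with empty events. *)
Lemma Pr_or (ps : ProbSpace) A B :
  meas ps A -> meas ps B -> (forall w, A w -> B w -> False) ->
  Pr ps (fun w => A w \/ B w) = Pr ps A + Pr ps B.
Proof.
  intros HA HB Hd.
  set (C := fun n : nat => match n with 0 => A | 1 => B | _ => fun _ => False end%nat).
  rewrite (pred_ext _ (fun w => exists n : nat, C n w)).
  - eapply uniqueness_sum.
    + apply Pr_cadd.
      * intros [|[|n]]; simpl; auto using meas_const.
      * intros [|[|n]] [|[|m]] w; simpl; try easy; eauto.
    + intros eps Heps; exists 1%nat; intros n Hn.
      replace (sum_f_R0 (fun n => Pr ps (C n)) n) with (Pr ps A + Pr ps B).
      { unfold Rdist; rewrite Rminus_diag, Rabs_R0; exact Heps. }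
      induction Hn; simpl; [easy|].
      rewrite <- IHHn; destruct m; [lia|]; simpl; rewrite Pr_empty; ring.
  - intros w; split; [intros [|]; [exists 0%nat | exists 1%nat] | intros [[|[|]] ?]];
      simpl in *; tauto.
Qed.

Notation meas01 := UnitInterval.meas01.
Notation Pr01 := UnitInterval.Pr01.
Notation unit_space := UnitInterval.unit_space.

Section Chain.
Context {S : Type}.

(** Inverse-transform sampling that also returns fresh randomness: given that the
    uniform [u] falls in the subinterval of the chosen branch, its rescaled position
    in that subinterval is again uniform on [0,1). *)
Fixpoint pick (l : list (R * S)) (s0 : S) (u : R) : S * R :=
  match l with
  | [] => (s0, u)
  | (w, s) :: l' => if Rle_dec w u then pick l' s0 (u - w) else (s, u / w)
  end.

Lemma pick_meas (l : list (R * S)) (s0 : S) (F : S * R -> Prop) :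
  (forall s, meas01 (fun v => F (s, v))) -> meas01 (fun u => F (pick l s0 u)).
Proof.
  intros HF; induction l as [|[w s] l IH]; simpl; [apply HF|].
  apply (meas_ext unit_space _ (fun u => (w <= u /\ F (pick l s0 (1 * u + - w))) \/
                                        (~ w <= u /\ F (s, / w * u + 0)))).
  - intros u; replace (1 * u + - w) with (u - w) by ring.
    replace (/ w * u + 0) with (u / w) by (unfold Rdiv; ring).
    destruct (Rle_dec w u); tauto.
  - apply (meas_or unit_space); apply (meas_and unit_space).
    + apply UnitInterval.meas01_le.
    + apply (UnitInterval.meas01_affine _ _ (fun v => F (pick l s0 v)) IH).
    + apply (meas_compl unit_space), UnitInterval.meas01_le.
    + apply (UnitInterval.meas01_affine _ _ (fun v => F (s, v))), HF.
Qed.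

Lemma meas01_itv (a b : R) : meas01 (fun u => a <= u /\ u < b).
Proof.
  apply (meas_and unit_space); [apply UnitInterval.meas01_le|].
  change (meas01 (fun u => u < b)).
  rewrite (pred_ext (fun u => u < b) (fun u => ~ b <= u)) by (intros; lra).
  apply (meas_compl unit_space), UnitInterval.meas01_le.
Qed.

(** The offset [a] makes the induction go through: once the first branch is removed, the remaining
    intervals start at [a + w]. *)
Lemma pick_Pr (l : list (R * S)) (s0 : S) (F : S * R -> Prop) (a : R) :
  (forall s, meas01 (fun v => F (s, v))) ->
  (forall ws, In ws l -> 0 <= fst ws) -> 0 <= a -> a + sumR (map fst l) <= 1 ->
  Pr01 (fun u => (a <= u /\ u < a + sumR (map fst l)) /\ F (pick l s0 (u - a))) =
  sumR (map (fun ws => fst ws * Pr01 (fun v => F (snd ws, v))) l).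
Proof.
  intros HF; revert a; induction l as [|[w s] l IH]; simpl; intros a Hl Ha Hsum.
  - apply (Pr_never unit_space); intros u; lra.
  - assert (Hw : 0 <= w) by (apply (Hl (w, s)); auto).
    assert (HW : 0 <= sumR (map fst l)).
    { assert (Hl' : forall ws, In ws l -> 0 <= fst ws) by auto.
      clear -Hl'; induction l; simpl; [lra|].
      pose proof (Hl' a (or_introl eq_refl)).
      assert (0 <= sumR (map fst l)) by (apply IHl; intros; apply Hl'; simpl; auto); lra. }
    rewrite <- (IH (a + w)); auto; try lra.
    assert (E : w * Pr01 (fun v => F (s, v)) =
      Pr01 (fun u => (a <= u /\ u < a + w) /\ F (s, (u - a) / w))).
    { destruct (Rle_lt_or_eq_dec _ _ Hw) as [Hw' | <-].
      - symmetry; apply (UnitInterval.Pr01_affine w a (fun v => F (s, v))); auto; lra.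
      (* A branch of weight zero occupies an empty interval, so the division by [w] is harmless. *)
      - rewrite Rmult_0_l; symmetry; apply (Pr_never unit_space); intros u; lra. }
    rewrite E, <- (Pr_or unit_space).
    + simpl; apply (Pr_ext unit_space); intros u.
      replace (u - (a + w)) with (u - a - w) by ring.
      destruct (Rle_dec w (u - a)); split; intros H;
        [right | destruct H as [H | H]; [lra|] | left | destruct H as [H | H]; [|lra]];
        (split; [lra | tauto]).
    + apply (meas_and unit_space); [apply meas01_itv|].
      apply (meas_ext unit_space _ (fun u => F (s, / w * u + - a / w))).
      * intros u; replace (/ w * u + - a / w) with ((u - a) / w)
          by (unfold Rdiv; ring); tauto.
      * apply (UnitInterval.meas01_affine _ _ (fun v => F (s, v))), HF.
    + apply (meas_and unit_space); [apply meas01_itv|].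
      apply (meas_ext unit_space _ (fun u => F (pick l s0 (1 * u + - (a + w))))).
      * intros u; replace (1 * u + - (a + w)) with (u - (a + w)) by ring; tauto.
      * apply (UnitInterval.meas01_affine _ _ (fun v => F (pick l s0 v))), pick_meas, HF.
    + intros u [H _] [H' _]; lra.
Qed.

(** Branches of weight zero are never selected, so an invariant has to survive only transitions of
    positive weight. *)
Lemma pick_spec (l : list (R * S)) (s0 : S) (u : R) :
  (forall ws, In ws l -> 0 <= fst ws) -> 0 <= u -> u < sumR (map fst l) ->
  exists w, In (w, fst (pick l s0 u)) l /\ 0 < w /\
    0 <= snd (pick l s0 u) /\ snd (pick l s0 u) < 1.
Proof.
  revert u; induction l as [|[w s] l IH]; simpl; intros u Hl H0 H1; [lra|].
  destruct (Rle_dec w u).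
  - destruct (IH (u - w)) as [w' Hw']; auto; try lra.
    exists w'; tauto.
  - assert (Hw : 0 < w) by lra.
    exists w; simpl; repeat split; auto.
    + apply Rmult_le_pos; [lra | apply Rlt_le, Rinv_0_lt_compat, Hw].
    + apply (Rmult_lt_reg_r w); [lra|]; unfold Rdiv; rewrite Rmult_assoc, Rinv_l; lra.
Qed.

Variable step : S -> list (R * S).

Definition next (sv : S * R) : S * R := pick (step (fst sv)) (fst sv) (snd sv).
Definition state (s : S) (t : nat) (u : R) : S := fst (Nat.iter t next (s, u)).

Lemma state_meas (E : S -> Prop) t s : meas01 (fun u => E (state s t u)).
Proof.
  unfold state; revert s; induction t as [|t IH]; intros s; [apply (meas_const unit_space (E s))|].
  apply (meas_ext unit_space _ (fun u => E (fst (Nat.iter t next (next (s, u)))))).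
  - intros u; rewrite Nat.iter_succ_r; tauto.
  - apply (pick_meas (step s) s (fun sv => E (fst (Nat.iter t next sv)))), IH.
Qed.

(** The invariant confines the requirements on [step] to states that can be reached. *)
Variable Inv : S -> Prop.
Hypothesis step_nonneg : forall s, Inv s -> forall ws, In ws (step s) -> 0 <= fst ws.
Hypothesis step_total : forall s, Inv s -> sumR (map fst (step s)) = 1.
Hypothesis step_Inv : forall s, Inv s -> forall w s', In (w, s') (step s) -> 0 < w -> Inv s'.

Lemma state_Inv s t u : Inv s -> 0 <= u -> u < 1 -> Inv (state s t u).
Proof.
  intros Hs H0 H1.
  assert (H : Inv (fst (Nat.iter t next (s, u))) /\
    0 <= snd (Nat.iter t next (s, u)) /\ snd (Nat.iter t next (s, u)) < 1); [|apply H].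
  induction t as [|t (IH1 & IH2 & IH3)]; [simpl; auto|].
  rewrite Nat.iter_succ; set (sv := Nat.iter t next (s, u)) in *; unfold next.
  destruct (pick_spec (step (fst sv)) (fst sv) (snd sv)) as (w & Hin & Hw & Hv); eauto.
  rewrite step_total; auto.
Qed.

Variables (N : nat) (x : S -> config) (p : config -> nat -> R).

(** Probability that a chain started at [c], with column [i] growing with probability [p c i],
    begins with [path]. The comparison with the next entry is left to the recursive call; after the
    last entry the sum is the total mass. *)
Fixpoint path_law (path : list config) (c : config) : R :=
  match path with
  | [] => 1
  | c0 :: path' =>
      if list_eq_dec Nat.eq_dec c c0
      then sumR (map (fun i => p c i * path_law path' (incr c i)) (seq 0 N)) else 0
  end.

(** Lumpability: the projected step depends on [s] only through [x s], so the projection is itself a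
    Markov chain. *)
Hypothesis step_marginal : forall s, Inv s -> forall F : config -> R,
  sumR (map (fun ws => fst ws * F (x (snd ws))) (step s)) =
  sumR (map (fun i => p (x s) i * F (incr (x s) i)) (seq 0 N)).

Definition follows (path : list config) (sv : S * R) : Prop :=
  forall t, (t < length path)%nat -> x (fst (Nat.iter t next sv)) = nth t path [].

Lemma follows_cons c path sv :
  follows (c :: path) sv <-> x (fst sv) = c /\ follows path (next sv).
Proof.
  unfold follows; split.
  - intros H; split; [apply (H 0%nat); simpl; lia|].
    intros t Ht; rewrite <- Nat.iter_succ_r; apply (H (Datatypes.S t)); simpl; lia.
  - intros [H1 H2] [|t] Ht; [exact H1|].
    rewrite Nat.iter_succ_r; apply H2; simpl in Ht; lia.
Qed.

Lemma follows_meas path s : meas01 (fun v => follows path (s, v)).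
Proof.
  revert s; induction path as [|c path IH]; intros s.
  - apply (meas_ext unit_space _ (fun _ => True)); [|apply meas_full].
    intros v; split; [easy | intros _ t Ht; simpl in Ht; lia].
  - apply (meas_ext unit_space _ (fun v => x s = c /\ follows path (next (s, v))));
      [intros; apply follows_cons|].
    apply (meas_and unit_space); [apply (meas_const unit_space (x s = c))|].
    apply (pick_meas (step s) s (follows path)), IH.
Qed.

Lemma follows_Pr path s : Inv s -> Pr01 (fun u => follows path (s, u)) = path_law path (x s).
Proof.
  revert s; induction path as [|c path IH]; intros s Hs; simpl.
  - rewrite <- (Pr_full unit_space); apply (Pr_ext unit_space).
    intros v; split; [easy | intros _ t Ht; simpl in Ht; lia].
  - rewrite (Pr_ext unit_space _ (fun v => x s = c /\ follows path (next (s, v))))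
      by (intros; apply follows_cons).
    destruct (list_eq_dec Nat.eq_dec (x s) c) as [Hc | Hc].
    + rewrite <- step_marginal by exact Hs.
      transitivity (sumR (map (fun ws => fst ws * Pr01 (fun v => follows path (snd ws, v)))
        (step s))).
      * rewrite <- (pick_Pr (step s) s (follows path) 0); eauto using follows_meas; try lra.
        2: rewrite step_total; auto; lra.
        rewrite step_total, <- (UnitInterval.Pr01_restrict (fun v => _ = _ /\ _)) by auto.
        apply (Pr_ext unit_space); intros u; unfold next; simpl.
        rewrite Rminus_0_r, Rplus_0_l; tauto.
      * apply sumR_map_ext; intros [w s'] Hin; simpl.
        (* The invariant, and with it the induction hypothesis, is available after transitions of
           positive weight; the others contribute zero. *)
        destruct (Rle_lt_or_eq_dec 0 w) as [Hw | <-].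
        -- apply (step_nonneg s Hs _ Hin).
        -- rewrite IH; eauto.
        -- ring.
    + apply (Pr_never unit_space); tauto.
Qed.

End Chain.

(** * Finite sums over lists *)

Lemma sumR_app (l1 l2 : list R) : sumR (l1 ++ l2) = sumR l1 + sumR l2.
Proof. induction l1; simpl; lra. Qed.

Lemma sumR_scal {A : Type} (k : R) (f : A -> R) (l : list A) :
  sumR (map (fun a => k * f a) l) = k * sumR (map f l).
Proof. induction l; simpl; lra. Qed.

Lemma sumR_plus {A : Type} (f g : A -> R) (l : list A) :
  sumR (map (fun a => f a + g a) l) = sumR (map f l) + sumR (map g l).
Proof. induction l; simpl; lra. Qed.

Lemma sumR_const {A : Type} (k : R) (l : list A) :
  sumR (map (fun _ => k) l) = INR (length l) * k.
Proof. induction l; [simpl; lra|]; cbn [map sumR fold_right length]; rewrite S_INR.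
  unfold sumR in IHl; lra. Qed.

Lemma sumR_nonneg {A : Type} (f : A -> R) (l : list A) :
  (forall a, In a l -> 0 <= f a) -> 0 <= sumR (map f l).
Proof.
  induction l as [|a l IH]; simpl; intros H; [lra|].
  pose proof (H a (or_introl eq_refl)).
  assert (0 <= sumR (map f l)) by auto; lra.
Qed.

Lemma sumR_le {A : Type} (f g : A -> R) (l : list A) :
  (forall a, In a l -> f a <= g a) -> sumR (map f l) <= sumR (map g l).
Proof.
  induction l as [|a l IH]; simpl; intros H; [lra|].
  pose proof (H a (or_introl eq_refl)).
  assert (sumR (map f l) <= sumR (map g l)) by auto; lra.
Qed.

Lemma sumR_perm {A : Type} (f : A -> R) (l l' : list A) :
  Permutation l l' -> sumR (map f l) = sumR (map f l').
Proof. induction 1; simpl; lra. Qed.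

Lemma sumR_flat_map {A B : Type} (g : B -> R) (f : A -> list B) (l : list A) :
  sumR (map g (flat_map f l)) = sumR (map (fun a => sumR (map g (f a))) l).
Proof. induction l; simpl; [easy|]; rewrite map_app, sumR_app; lra. Qed.

Lemma sumR_swap {A B : Type} (f : A -> B -> R) (l : list A) (l' : list B) :
  sumR (map (fun a => sumR (map (f a) l')) l) =
  sumR (map (fun b => sumR (map (fun a => f a b) l)) l').
Proof.
  induction l as [|a l IH]; simpl.
  - rewrite sumR_const; lra.
  - rewrite IH, <- sumR_plus; easy.
Qed.

Lemma sumR_single {A : Type} (f : A -> R) (l : list A) (a : A) :
  NoDup l -> In a l -> (forall b, In b l -> b <> a -> f b = 0) -> sumR (map f l) = f a.
Proof.
  induction l as [|b l IH]; simpl; intros Hn Hin Hf; [easy|].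
  inversion_clear Hn.
  destruct Hin as [-> | Hin].
  - rewrite (sumR_map_ext f (fun _ => 0)), sumR_const; [lra|].
    intros c Hc; apply Hf; auto; intros ->; easy.
  - rewrite IH, (Hf b); auto; [lra|]; intros ->; easy.
Qed.

Lemma sumR_telescope (g : nat -> R) (n : nat) :
  sumR (map (fun k => g (S k) - g k) (seq 0 n)) = g n - g 0%nat.
Proof.
  induction n; [simpl; lra|].
  rewrite seq_S, map_app, sumR_app, IHn; simpl; lra.
Qed.

Lemma map_nth_seq {A : Type} (l : list A) (a : A) :
  map (fun k => nth k l a) (seq 0 (length l)) = l.
Proof.
  apply (nth_ext _ _ a a); rewrite length_map, length_seq; [easy|].
  intros n Hn; rewrite (nth_indep _ a (nth 0 l a)) by (rewrite length_map, length_seq; easy).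
  rewrite (map_nth (fun k => nth k l a)), seq_nth; easy.
Qed.

(** * Growing a column, and path probabilities of the resulting chains *)

Lemma length_incr c i : length (incr c i) = length c.
Proof. revert i; induction c; destruct i; simpl; auto. Qed.

Lemma height_incr c i j : (i < length c)%nat ->
  height (incr c i) j = (if Nat.eqb i j then S (height c j) else height c j).
Proof.
  unfold height; revert i j; induction c; intros [|i] [|j]; simpl; intros H; try easy; try lia.
  apply IHc; lia.
Qed.

Lemma incr_inj c i j : (i < length c)%nat -> (j < length c)%nat ->
  incr c i = incr c j -> i = j.
Proof.
  intros Hi Hj E; apply (f_equal (fun d => height d i)) in E.
  rewrite !height_incr, Nat.eqb_refl in E by easy.
  destruct (Nat.eqb_spec j i); [easy | lia].
Qed.

(** A functional form of the relation [prob]. Every value that [prob] allows must be that of [p],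
    which is the direction in which [markov_chain] consumes a kernel. *)
Definition is_law (N : nat) (prob : config -> nat -> R -> Prop) (p : config -> nat -> R) :=
  forall c, length c = N ->
    (forall i, (i < N)%nat -> 0 <= p c i) /\
    sumR (map (p c) (seq 0 N)) = 1 /\
    (forall i r, (i < N)%nat -> prob c i r -> r = p c i).

Lemma last_indep {A : Type} (l : list A) (a b d : A) : last (d :: l) a = last (d :: l) b.
Proof.
  revert d; induction l as [|e l IH]; intros d; [easy|].
  change (last (e :: l) a = last (e :: l) b); apply IH.
Qed.

(** [path_law] unfolds from the front whereas [markov_chain] extends a path at its end. The
    induction carries the factor [q] through the sums; in the base case injectivity of [incr] leaves
    at most one column. *)
Lemma path_law_snoc N prob p (path : list config) (c0 c c' : config) (q : R) :
  is_law N prob p -> length c0 = N ->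
  add_kernel N prob (last (c :: path) c) c' q ->
  path_law N p ((c :: path) ++ [c']) c0 = path_law N p (c :: path) c0 * q.
Proof.
  intros Hlaw; revert c0 c; induction path as [|c1 path IH]; intros c0 c Hc0 HK.
  - simpl in *; destruct (list_eq_dec Nat.eq_dec c0 c) as [<- | _]; [|lra].
    rewrite (sumR_map_ext (fun i => p c0 i * 1) (p c0)) by (intros; lra).
    destruct (Hlaw c0 Hc0) as (_ & Hsum & Hprob); rewrite Hsum, Rmult_1_l.
    (* Past the end of the path the inner sum is the total mass one, so only the test against [c']
       remains. *)
    assert (Hterm : forall i, p c0 i * (if list_eq_dec Nat.eq_dec (incr c0 i) c'
      then sumR (map (fun i0 => p (incr c0 i) i0 * 1) (seq 0 N)) else 0) =
      if list_eq_dec Nat.eq_dec (incr c0 i) c' then p c0 i else 0).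
    { intros i; destruct (list_eq_dec _ _ _); [|lra].
      rewrite (sumR_map_ext _ (p (incr c0 i))) by (intros; lra).
      destruct (Hlaw (incr c0 i)) as (_ & -> & _); [rewrite length_incr; easy | lra]. }
    rewrite (sumR_map_ext _ _ _ (fun i _ => Hterm i)).
    destruct HK as [(i & Hi & -> & Hq) | [Hno ->]].
    + rewrite (sumR_single _ _ i).
      * destruct (list_eq_dec _ _ _); [symmetry; auto | easy].
      * apply seq_NoDup.
      * apply in_seq; lia.
      * intros j Hj Hji; apply in_seq in Hj.
        destruct (list_eq_dec _ _ _) as [E|]; [|easy].
        apply incr_inj in E; lia.
    + rewrite (sumR_map_ext _ (fun _ => 0)); [rewrite sumR_const; lra|].
      intros i Hi; apply in_seq in Hi.
      destruct (list_eq_dec _ _ _); [|easy]; subst c'; exfalso; apply (Hno i); [lia | easy].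
  - change ((c :: c1 :: path) ++ [c']) with (c :: (c1 :: path) ++ [c']).
    change (path_law N p (c :: (c1 :: path) ++ [c']) c0) with
      (if list_eq_dec Nat.eq_dec c0 c then sumR (map (fun i => p c0 i *
        path_law N p ((c1 :: path) ++ [c']) (incr c0 i)) (seq 0 N)) else 0).
    change (path_law N p (c :: c1 :: path) c0) with
      (if list_eq_dec Nat.eq_dec c0 c then sumR (map (fun i => p c0 i *
        path_law N p (c1 :: path) (incr c0 i)) (seq 0 N)) else 0).
    destruct (list_eq_dec Nat.eq_dec c0 c); [|lra].
    rewrite Rmult_comm, <- sumR_scal; apply sumR_map_ext; intros i _.
    rewrite IH; [ring | rewrite length_incr; easy |].
    change (last (c :: c1 :: path) c) with (last (c1 :: path) c) in HK.
    rewrite (last_indep _ c1 c); easy.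
Qed.

(** * The domination order *)

(** Truncated subtraction is the positive part: this is the sum of [(x - m)^+] as a function of the
    level [m]. *)
Definition excess (m : nat) (l : list nat) : nat := list_sum (map (fun x => x - m)%nat l).
Definition count_ge (m : nat) (l : list nat) : nat := length (filter (Nat.leb m) l).

(** An equivalent form of [more_mono] without rearrangements: partial sums of the
    decreasing rearrangement and the functions [excess m] are Legendre duals. *)
Definition dominates (c d : config) : Prop :=
  size c = size d /\ forall m, (excess m d <= excess m c)%nat.

Lemma excess_perm m l l' : Permutation l l' -> excess m l = excess m l'.
Proof. unfold excess, list_sum; induction 1; simpl; lia. Qed.

Lemma count_ge_perm m l l' : Permutation l l' -> count_ge m l = count_ge m l'.
Proof.
  unfold count_ge; induction 1; simpl; auto; try congruence;
    repeat destruct (_ <=? _)%nat; simpl; auto.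
Qed.

(** [count_ge] is the discrete slope of [excess]. *)
Lemma excess_S m l : (excess m l = excess (S m) l + count_ge (S m) l)%nat.
Proof.
  unfold excess, count_ge; induction l as [|a l IH]; [easy|].
  cbn [map list_sum fold_right filter] in *.
  destruct (Nat.leb_spec (S m) a); cbn [length]; unfold list_sum in *; lia.
Qed.

Lemma excess_incr m c i : (i < length c)%nat ->
  excess m (incr c i) = (excess m c + if Nat.leb m (height c i) then 1 else 0)%nat.
Proof.
  unfold excess, height; revert i; induction c as [|a c IH]; intros [|i] H;
    cbn [length] in H; try lia; cbn [incr map list_sum fold_right nth].
  - destruct (Nat.leb_spec m a); lia.
  - specialize (IH i ltac:(lia)); unfold list_sum in *; lia.
Qed.

Lemma size_incr c i : (i < length c)%nat -> size (incr c i) = S (size c).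
Proof.
  unfold size; revert i; induction c as [|a c IH]; intros [|i] H; simpl in *; try lia.
  rewrite IH; lia.
Qed.

(** In a decreasing list the entries reaching level [m] form an initial segment, of length
    [count_ge m l]. *)
Lemma count_ge_rank l k m : StronglySorted ge l -> (k < length l)%nat ->
  ((m <= nth k l 0)%nat -> (k < count_ge m l)%nat) /\
  ((nth k l 0 < m)%nat -> (count_ge m l <= k)%nat).
Proof.
  unfold count_ge; intros Hs; revert k; induction Hs as [|a l Hs IH Ha]; intros k Hk;
    simpl in *; [lia|].
  rewrite Forall_forall in Ha.
  destruct k as [|k].
  - split; intros H.
    + destruct (Nat.leb_spec m a); simpl; lia.
    + destruct (Nat.leb_spec m a); simpl; [lia|].
      destruct (filter (Nat.leb m) l) as [|b f] eqn:E; simpl; [lia|].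
      assert (Hb : In b (filter (Nat.leb m) l)) by (rewrite E; simpl; auto).
      apply filter_In in Hb; destruct Hb as [Hb Hmb].
      apply Nat.leb_le in Hmb; specialize (Ha b Hb); lia.
  - destruct (IH k ltac:(lia)) as [IH1 IH2].
    specialize (Ha (nth k l 0%nat) (@nth_In _ k l 0%nat ltac:(lia))).
    destruct (Nat.leb_spec m a); simpl; split; intros H'; lia.
Qed.

(** Every entry is at most [m] plus its positive part above [m]: the easy half of the duality. *)
Lemma prefix_le m k l : (list_sum (firstn k l) <= k * m + excess m l)%nat.
Proof.
  unfold excess; revert k; induction l as [|a l IH]; intros [|k]; simpl; try lia.
  specialize (IH k); unfold list_sum in *; lia.
Qed.

(** Equality in [prefix_le] when [m] is the last entry of the prefix: the earlier entries are at
    least [m] and the later ones have no excess. *)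
Lemma prefix_eq k l : StronglySorted ge l -> (k < length l)%nat ->
  list_sum (firstn (S k) l) = (S k * nth k l 0 + excess (nth k l 0) l)%nat.
Proof.
  intros Hs; revert k; induction Hs as [|a l Hs IH Ha]; intros k Hk; [simpl in Hk; lia|].
  rewrite Forall_forall in Ha; cbn [length] in Hk.
  destruct k as [|k].
  - assert (E : forall l', (forall x, In x l' -> (a >= x)%nat) -> excess a l' = 0%nat).
    { unfold excess; induction l' as [|b l' IH']; simpl; intros H; [easy|].
      rewrite IH' by auto; pose proof (H b (or_introl eq_refl)); lia. }
    simpl; rewrite (E (a :: l)); [lia|].
    intros x [-> | Hx]; [lia | auto].
  - change (firstn (S (S k)) (a :: l)) with (a :: firstn (S k) l).
    change (nth (S k) (a :: l) 0%nat) with (nth k l 0%nat).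
    specialize (Ha (nth k l 0%nat) (@nth_In _ k l 0%nat ltac:(lia))).
    specialize (IH k ltac:(lia)); set (m := nth k l 0%nat) in *.
    unfold excess in *; cbn [list_sum fold_right map]; unfold list_sum in *; lia.
Qed.

Lemma excess_0 c : excess 0 c = size c.
Proof. unfold excess, size; induction c; simpl; unfold list_sum in *; lia. Qed.

(** The excesses are compared at the level where the bound is sharp for [c]. *)
Lemma dominates_prefix c d rs rt k : dominates c d ->
  Permutation rs c -> StronglySorted ge rs -> Permutation rt d -> (k <= length c)%nat ->
  (list_sum (firstn k rt) <= list_sum (firstn k rs))%nat.
Proof.
  intros [_ H] Hrs Hs Hrt Hk.
  destruct k as [|k]; [simpl; lia|].
  rewrite (prefix_eq k rs Hs) by (rewrite (Permutation_length Hrs); lia).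
  pose proof (prefix_le (nth k rs 0%nat) (S k) rt) as Hle.
  rewrite (excess_perm _ _ _ Hrt) in Hle; rewrite (excess_perm _ _ _ Hrs).
  specialize (H (nth k rs 0%nat)); lia.
Qed.

Lemma dominates_more_mono N c d : length c = N -> dominates c d -> more_mono N c d.
Proof.
  intros Hc H; split; [apply H|].
  intros rs rt [Hrs Hss] [Hrt _] k Hk.
  apply (dominates_prefix c d); auto; [|lia].
  apply Sorted_StronglySorted; auto; intros x y z; lia.
Qed.

(** * Rankings of the columns by decreasing height, ties broken arbitrarily *)

Definition ranking (c : config) (pi : list nat) : Prop :=
  Permutation pi (seq 0 (length c)) /\
  StronglySorted (fun i j => height c j <= height c i)%nat pi.

(** Insertion sort with respect to the key [f]. *)
Lemma StronglySorted_exists (f : nat -> nat) (l : list nat) :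
  exists l', Permutation l' l /\ StronglySorted (fun i j => f j <= f i)%nat l'.
Proof.
  induction l as [|a l (l' & Hp & Hs)]; [exists []; split; constructor|].
  assert (Hins : exists l'', Permutation l'' (a :: l') /\
    StronglySorted (fun i j => f j <= f i)%nat l'').
  { clear Hp; induction Hs as [|b l' Hs IH Hb]; [exists [a]; split; repeat constructor|].
    destruct (Nat.le_gt_cases (f b) (f a)) as [Hab | Hab].
    - exists (a :: b :: l'); split; [easy|].
      constructor; [constructor; easy|].
      rewrite Forall_forall in *; intros x [<- | Hx]; [easy|].
      specialize (Hb x Hx); simpl in Hb; lia.
    - destruct IH as (l'' & Hp & Hs'').
      exists (b :: l''); split; [rewrite Hp; apply perm_swap|].
      constructor; [easy|]; rewrite Forall_forall in *; intros x Hx.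
      apply (Permutation_in _ Hp) in Hx; destruct Hx as [<- | Hx]; [lia | auto]. }
  destruct Hins as (l'' & Hp'' & Hs''); exists l''; split; [|easy].
  rewrite Hp'', Hp; easy.
Qed.

Lemma ranking_exists c : exists pi, ranking c pi.
Proof. apply StronglySorted_exists. Qed.

Lemma ranking_heights c pi : ranking c pi ->
  Permutation (map (height c) pi) c /\ StronglySorted ge (map (height c) pi).
Proof.
  intros [Hp Hs]; split.
  - rewrite <- (map_nth_seq c 0%nat) at 2; apply Permutation_map, Hp.
  - clear Hp; induction Hs as [|a l Hs IH Ha]; simpl; constructor; auto.
    rewrite Forall_map; revert Ha; apply Forall_impl; intros; lia.
Qed.

Lemma ranking_length c pi : ranking c pi -> length pi = length c.
Proof. intros [Hp _]; rewrite (Permutation_length Hp), length_seq; easy. Qed.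

Lemma ranking_nth c pi k : ranking c pi -> (k < length c)%nat -> (nth k pi 0 < length c)%nat.
Proof.
  intros H Hk; rewrite <- (ranking_length c pi H) in Hk.
  pose proof (Permutation_in _ (proj1 H) (nth_In pi 0%nat Hk)) as Hin.
  apply in_seq in Hin; lia.
Qed.

(* If the inequality failed at level [m], then [excess m c = excess m d] while strictly
   fewer columns reach [m] in [c] than in [d], contradicting the inequality at [m - 1]. *)
Lemma dominates_incr c d pi rho k l : dominates c d -> length c = length d ->
  ranking c pi -> ranking d rho -> (k <= l)%nat -> (l < length d)%nat ->
  dominates (incr c (nth k pi 0%nat)) (incr d (nth l rho 0%nat)).
Proof.
  intros [Hsz H] Hlen Hpi Hrho Hkl Hl.
  pose proof (ranking_nth c pi k Hpi ltac:(lia)) as Hi.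
  pose proof (ranking_nth d rho l Hrho Hl) as Hj.
  split; [rewrite !size_incr; auto|].
  intros m; rewrite !excess_incr by easy.
  pose proof (H m) as Hm.
  destruct (Nat.leb_spec m (height d (nth l rho 0%nat))) as [Hd | Hd];
    destruct (Nat.leb_spec m (height c (nth k pi 0%nat))) as [Hc | Hc]; try lia.
  destruct (Nat.eq_dec (excess m d) (excess m c)) as [E | E]; [exfalso | lia].
  destruct m as [|m]; [lia|].
  destruct (ranking_heights c pi Hpi) as [Pc Sc], (ranking_heights d rho Hrho) as [Pd Sd].
  pose proof (ranking_length _ _ Hpi) as Lc; pose proof (ranking_length _ _ Hrho) as Ld.
  destruct (count_ge_rank _ k (S m) Sc) as [_ Rc]; [rewrite length_map; lia|].
  destruct (count_ge_rank _ l (S m) Sd) as [Rd _]; [rewrite length_map; lia|].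
  rewrite (nth_indep _ 0%nat (height c 0)), (map_nth (height c)) in Rc by (rewrite length_map; lia).
  rewrite (nth_indep _ 0%nat (height d 0)), (map_nth (height d)) in Rd by (rewrite length_map; lia).
  specialize (Rc Hc); specialize (Rd Hd).
  rewrite (count_ge_perm _ _ _ Pc) in Rc; rewrite (count_ge_perm _ _ _ Pd) in Rd.
  specialize (H m); rewrite (excess_S m c), (excess_S m d) in H; lia.
Qed.

(** * The quantile coupling of ranks *)

(** For [a <= b] and [x <= y], the length of [[a,b]] intersected with [[x,y]]. *)
Definition overlap (a b x y : R) : R := Rmax a (Rmin b y) - Rmax a (Rmin b x).

(** Innermost comparisons are split first, so that each case hypothesis relates expressions free of
    [Rle_dec]. *)
Ltac case_minmax :=
  unfold overlap, Rmax, Rmin;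
  repeat match goal with |- context [Rle_dec ?a ?b] =>
    lazymatch constr:((a, b)) with context [Rle_dec _ _] => fail | _ => destruct (Rle_dec a b) end
  end; try lra.

Lemma overlap_sym a b x y : a <= b -> x <= y -> overlap a b x y = overlap x y a b.
Proof. intros; case_minmax. Qed.

Lemma overlap_nonneg a b x y : a <= b -> x <= y -> 0 <= overlap a b x y.
Proof. intros; case_minmax. Qed.

Lemma overlap_eq_0 a b x y : a <= b -> x <= y -> y <= a -> overlap a b x y = 0.
Proof. intros; case_minmax. Qed.

Definition prefix_mass (f : nat -> R) (pi : list nat) (k : nat) : R :=
  sumR (map f (firstn k pi)).

Lemma prefix_mass_S f pi k : (k < length pi)%nat ->
  prefix_mass f pi (S k) = prefix_mass f pi k + f (nth k pi 0%nat).
Proof.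
  unfold prefix_mass; revert k; induction pi as [|a pi IH]; intros k Hk; [simpl in Hk; lia|].
  destruct k as [|k]; [simpl; lra|].
  change (firstn (S (S k)) (a :: pi)) with (a :: firstn (S k) pi).
  change (firstn (S k) (a :: pi)) with (a :: firstn k pi).
  change (nth (S k) (a :: pi) 0%nat) with (nth k pi 0%nat).
  cbn [map sumR fold_right]; simpl in Hk.
  specialize (IH k ltac:(lia)); unfold sumR in *; lra.
Qed.

Lemma prefix_mass_mono f pi k l : (forall i, In i pi -> 0 <= f i) ->
  (k <= l)%nat -> (l <= length pi)%nat -> prefix_mass f pi k <= prefix_mass f pi l.
Proof.
  intros Hf Hkl; induction Hkl as [|l Hkl IH]; intros Hl; [lra|].
  rewrite prefix_mass_S by lia.
  pose proof (Hf _ (@nth_In _ l pi 0%nat ltac:(lia))); specialize (IH ltac:(lia)); lra.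
Qed.

Lemma prefix_mass_all f pi k : (length pi <= k)%nat -> prefix_mass f pi k = sumR (map f pi).
Proof. intros H; unfold prefix_mass; rewrite firstn_all2; easy. Qed.

(** [overlap a b] is an increment of the projection of the line onto [a,b], so the sum
    telescopes. *)
Lemma overlap_sum (g : nat -> R) (n : nat) (a b : R) :
  g 0%nat <= a -> a <= b -> b <= g n ->
  sumR (map (fun l => overlap a b (g l) (g (S l))) (seq 0 n)) = b - a.
Proof.
  intros Ha Hab Hb; unfold overlap.
  rewrite (sumR_telescope (fun l => Rmax a (Rmin b (g l)))); case_minmax.
Qed.

Section Quantile.
Variables (N : nat) (p q : config -> nat -> R) (ord : config -> list nat).
Hypothesis ord_ranking : forall c, ranking c (ord c).

Definition mass_p (c : config) (k : nat) : R := prefix_mass (p c) (ord c) k.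
Definition mass_q (c : config) (k : nat) : R := prefix_mass (q c) (ord c) k.

(** The quantile coupling: the columns of rank [k] in [c] and of rank [l] in [d] grow
    together with probability the overlap of the intervals of [0,1] which the two laws
    attribute to these ranks. *)
Definition quantile_step (cd : config * config) : list (R * (config * config)) :=
  let (c, d) := cd in
  flat_map (fun k => map (fun l =>
    (overlap (mass_p c k) (mass_p c (S k)) (mass_q d l) (mass_q d (S l)),
     (incr c (nth k (ord c) 0%nat), incr d (nth l (ord d) 0%nat))))
    (seq 0 N)) (seq 0 N).

Lemma sumR_ranking (f : nat -> R) c : length c = N ->
  sumR (map (fun k => f (nth k (ord c) 0%nat)) (seq 0 N)) = sumR (map f (seq 0 N)).
Proof.
  intros Hc; rewrite <- (sumR_perm f (ord c) (seq 0 N)).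
  - pose proof (map_nth_seq (ord c) 0%nat) as E.
    rewrite (ranking_length c), Hc in E by apply ord_ranking.
    apply (f_equal (map f)) in E; rewrite map_map in E; rewrite <- E; easy.
  - rewrite <- Hc; apply ord_ranking.
Qed.

Lemma mass_step (f : config -> nat -> R) prob c k :
  is_law N prob f -> length c = N -> (k < N)%nat ->
  prefix_mass (f c) (ord c) 0 = 0 /\ prefix_mass (f c) (ord c) N = 1 /\
  prefix_mass (f c) (ord c) (S k) = prefix_mass (f c) (ord c) k + f c (nth k (ord c) 0%nat) /\
  0 <= prefix_mass (f c) (ord c) k <= prefix_mass (f c) (ord c) (S k) /\
  prefix_mass (f c) (ord c) (S k) <= 1.
Proof.
  intros Hf Hc Hk.
  destruct (Hf c Hc) as (Hnn & Htot & _).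
  pose proof (ranking_length c (ord c) (ord_ranking c)) as Hl.
  assert (Hpos : forall i, In i (ord c) -> 0 <= f c i).
  { intros i Hi; apply Hnn.
    apply (Permutation_in _ (proj1 (ord_ranking c))), in_seq in Hi; lia. }
  assert (H0 : prefix_mass (f c) (ord c) 0 = 0) by easy.
  assert (HN : prefix_mass (f c) (ord c) N = 1).
  { rewrite prefix_mass_all by lia.
    rewrite (sumR_perm _ _ _ (proj1 (ord_ranking c))), Hc; exact Htot. }
  repeat split; auto.
  - apply prefix_mass_S; lia.
  - rewrite <- H0; apply prefix_mass_mono; auto; lia.
  - apply prefix_mass_mono; auto; lia.
  - rewrite <- HN; apply prefix_mass_mono; auto; lia.
Qed.

Variables prob1 prob2 : config -> nat -> R -> Prop.
Hypothesis law_p : is_law N prob1 p.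
Hypothesis law_q : is_law N prob2 q.

(** For a fixed rank [k], the intervals of the second law partition [0,1], so the overlaps add up to
    the length of the interval of rank [k]. *)
Lemma quantile_step_marginal_l (F : config -> R) c d : length c = N -> length d = N ->
  sumR (map (fun ws => fst ws * F (fst (snd ws))) (quantile_step (c, d))) =
  sumR (map (fun i => p c i * F (incr c i)) (seq 0 N)).
Proof.
  intros Hc Hd; simpl; rewrite sumR_flat_map.
  rewrite <- (sumR_ranking (fun i => p c i * F (incr c i)) c Hc).
  apply sumR_map_ext; intros k Hk; apply in_seq in Hk.
  rewrite map_map; simpl.
  set (y := F _); rewrite (sumR_map_ext _ (fun l => y *
    overlap (mass_p c k) (mass_p c (S k)) (mass_q d l) (mass_q d (S l)))) by (intros; ring).
  rewrite sumR_scal.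
  destruct (mass_step p prob1 c k) as (_ & _ & E & H1 & H2); auto; [lia|].
  destruct (mass_step q prob2 d k) as (H3 & H4 & _); auto; [lia|].
  rewrite overlap_sum; unfold mass_p, mass_q; [rewrite E; ring | lra ..].
Qed.

Lemma quantile_step_marginal_r (F : config -> R) c d : length c = N -> length d = N ->
  sumR (map (fun ws => fst ws * F (snd (snd ws))) (quantile_step (c, d))) =
  sumR (map (fun i => q d i * F (incr d i)) (seq 0 N)).
Proof.
  intros Hc Hd; simpl; rewrite sumR_flat_map.
  rewrite (sumR_map_ext _ (fun k => sumR (map (fun l =>
    overlap (mass_p c k) (mass_p c (S k)) (mass_q d l) (mass_q d (S l)) *
    F (incr d (nth l (ord d) 0%nat))) (seq 0 N)))) by (intros; rewrite map_map; easy).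
  (* Summing over the ranks of [c] first exchanges the roles of the two partitions. *)
  rewrite sumR_swap, <- (sumR_ranking (fun i => q d i * F (incr d i)) d Hd).
  apply sumR_map_ext; intros l Hl; apply in_seq in Hl.
  destruct (mass_step q prob2 d l) as (_ & _ & E & H1 & H2); auto; [lia|].
  rewrite (sumR_map_ext _ (fun k => F (incr d (nth l (ord d) 0%nat)) *
    overlap (mass_q d l) (mass_q d (S l)) (mass_p c k) (mass_p c (S k)))).
  - rewrite sumR_scal.
    destruct (mass_step p prob1 c l) as (H3 & H4 & _); auto; [lia|].
    rewrite overlap_sum; unfold mass_p, mass_q; [rewrite E; ring | lra ..].
  - intros k Hk; apply in_seq in Hk.
    destruct (mass_step p prob1 c k) as (_ & _ & _ & H3 & _); auto; [lia|].
    rewrite overlap_sym; unfold mass_p, mass_q; [ring | lra ..].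
Qed.

Definition coupled (cd : config * config) : Prop :=
  length (fst cd) = N /\ length (snd cd) = N /\ dominates (fst cd) (snd cd).

(** Stochastic comparison of ranks, by which the rank drawn in [c] never exceeds the one drawn in
    [d]. *)
Hypothesis mass_le : forall c d, coupled (c, d) -> forall k, (k <= N)%nat ->
  mass_q d k <= mass_p c k.

Lemma quantile_step_nonneg cd : coupled cd ->
  forall ws, In ws (quantile_step cd) -> 0 <= fst ws.
Proof.
  destruct cd as [c d]; intros (Hc & Hd & _) ws Hws; simpl in *.
  apply in_flat_map in Hws; destruct Hws as (k & Hk & Hws).
  apply in_map_iff in Hws; destruct Hws as (l & <- & Hl).
  apply in_seq in Hk, Hl.
  destruct (mass_step p prob1 c k) as (_ & _ & _ & H1 & _); auto; [lia|].
  destruct (mass_step q prob2 d l) as (_ & _ & _ & H2 & _); auto; [lia|].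
  apply overlap_nonneg; unfold mass_p, mass_q; lra.
Qed.

Lemma quantile_step_total cd : coupled cd -> sumR (map fst (quantile_step cd)) = 1.
Proof.
  destruct cd as [c d]; intros (Hc & Hd & _); simpl fst in *; simpl snd in *.
  rewrite (sumR_map_ext _ (fun ws => fst ws * 1)) by (intros; ring).
  rewrite (quantile_step_marginal_l (fun _ => 1)) by auto.
  rewrite (sumR_map_ext _ (p c)) by (intros; ring).
  apply law_p, Hc.
Qed.

Lemma quantile_step_coupled cd : coupled cd ->
  forall w cd', In (w, cd') (quantile_step cd) -> 0 < w -> coupled cd'.
Proof.
  destruct cd as [c d]; intros (Hc & Hd & Hdom) w cd' Hin Hw; simpl in *.
  apply in_flat_map in Hin; destruct Hin as (k & Hk & Hin).
  apply in_map_iff in Hin; destruct Hin as (l & E & Hl).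
  apply in_seq in Hk, Hl; injection E as <- <-.
  repeat split; simpl; try (rewrite length_incr; easy); apply dominates_incr; auto; try lia;
    (* If [l < k], the interval of rank [l] ends at most at [mass_p c (S l) <= mass_p c k], where
       that of rank [k] begins; the overlap is then zero, against [0 < w]. *)
    destruct (Nat.le_gt_cases k l) as [Hkl | Hkl]; auto; exfalso;
    (destruct (mass_step p prob1 c k) as (_ & _ & _ & H1 & _); auto; [lia|];
     destruct (mass_step q prob2 d l) as (_ & _ & _ & H2 & _); auto; [lia|];
     rewrite overlap_eq_0 in Hw; unfold mass_p, mass_q in *; try lra;
     apply Rle_trans with (prefix_mass (p c) (ord c) (S l));
     [apply (mass_le c d); [repeat split; apply Hdom || auto | lia]|];
     apply prefix_mass_mono;
     [| lia | rewrite (ranking_length c) by auto; lia];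
     intros i Hi; apply law_p; auto;
     apply (Permutation_in _ (proj1 (ord_ranking c))), in_seq in Hi; lia).
Qed.

End Quantile.

(** Reduces the comparison of two processes to an inequality between the masses of the top ranks in
    two ordered configurations. *)
Lemma coupling_of_ranked_domination N prob1 prob2 p q :
  is_law N prob1 p -> is_law N prob2 q ->
  (forall c d pi rho k, length c = N -> length d = N -> dominates c d ->
    ranking c pi -> ranking d rho -> (k <= N)%nat ->
    prefix_mass (q d) rho k <= prefix_mass (p c) pi k) ->
  dominating_coupling N (add_kernel N prob1) (add_kernel N prob2).
Proof.
  intros Hp Hq Hle.
  destruct (functional_choice ranking ranking_exists) as [ord Hord].
  set (step := quantile_step N p q ord).
  set (c0 := repeat 0%nat N); set (s0 := (c0, c0)).
  assert (Hc0 : length c0 = N) by apply repeat_length.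
  assert (Hs0 : coupled N s0) by (repeat split; auto).
  assert (Hmass : forall c d, coupled N (c, d) -> forall k, (k <= N)%nat ->
    mass_q q ord d k <= mass_p p ord c k).
  { intros c d (Hc & Hd & Hdom) k Hk; apply Hle; auto. }
  assert (Hnn := quantile_step_nonneg N p q ord Hord prob1 prob2 Hp Hq).
  assert (Htot := quantile_step_total N p q ord Hord prob1 prob2 Hp Hq).
  assert (Hinv := quantile_step_coupled N p q ord Hord prob1 prob2 Hp Hq Hmass).
  (* One argument serves both marginals: [x] is the projection and [f] its law. *)
  assert (Hmarkov : forall (x : config * config -> config) prob f, is_law N prob f ->
    x s0 = c0 ->
    (forall s, coupled N s -> forall F : config -> R,
      sumR (map (fun ws => fst ws * F (x (snd ws))) (step s)) =
      sumR (map (fun i => f (x s) i * F (incr (x s) i)) (seq 0 N))) ->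
    markov_chain (ps := unit_space) (fun t u => x (state step s0 t u)) c0 (add_kernel N prob)).
  { intros x prob f Hf Hx Hmarg; split.
    - rewrite <- (Pr_full unit_space); apply (Pr_ext unit_space); intros u; easy.
    - intros path c c' r HK.
      assert (E : forall path', Pr unit_space (path_event (ps := unit_space)
          (fun t u => x (state step s0 t u)) path') = path_law N f path' c0).
      { intros path'; rewrite <- Hx.
        apply (follows_Pr step (coupled N) Hnn Htot Hinv N x f Hmarg path' s0 Hs0). }
      rewrite !E; apply (path_law_snoc N prob); auto. }
  exists unit_space, (fun t u => fst (state step s0 t u)), (fun t u => snd (state step s0 t u)).
  split; [intros t c; apply (state_meas step (fun s => fst s = c))|].
  split; [intros t c; apply (state_meas step (fun s => snd s = c))|].
  split.
  { apply (Hmarkov fst prob1 p); auto.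
    intros [c d] (Hc & Hd & _) F; apply (quantile_step_marginal_l N p q ord Hord prob1 prob2); auto. }
  split.
  { apply (Hmarkov snd prob2 q); auto.
    intros [c d] (Hc & Hd & _) F; apply (quantile_step_marginal_r N p q ord Hord prob1 prob2); auto. }
  (* Outside [0,1) the rescaled positions mean nothing, so the order is claimed on this event of
     probability one. *)
  exists (fun u : Omega unit_space => 0 <= u /\ u < 1).
  split; [apply meas01_itv|].
  split; [apply UnitInterval.Pr01_unit|].
  intros u [H0 H1] t.
  destruct (state_Inv step (coupled N) Hnn Htot Hinv s0 t u Hs0 H0 H1) as (Hc & Hd & Hdom).
  apply dominates_more_mono; auto.
Qed.

(** * Landing probabilities of an explorer *)

Lemma sumR_words_S {A : Type} (al : list A) (n : nat) (g : list A -> R) :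
  sumR (map g (words al (S n))) =
  sumR (map (fun w => sumR (map (fun a => g (a :: w)) al)) (words al n)).
Proof.
  simpl; rewrite sumR_flat_map; apply sumR_map_ext; intros w _; rewrite map_map; easy.
Qed.

Lemma stops_at_cons c i z x xs s ss :
  stops_at c i z (x :: xs) (s :: ss) =
  (Z.ltb (Z.of_nat (height c x)) z && stops_at c i (z + fst s) xs ss)%bool.
Proof. destruct s, xs; easy. Qed.

(** [stop_term] with a free starting height, as required by a recursion on the first step. *)
Definition stop_prob (N : nat) (steps : list (Z * R)) (c : config) (n : nat) (z : Z) (i : nat) : R :=
  sumR (map (fun xs => sumR (map (fun ss =>
      if stops_at c i z xs ss then (/ INR N) ^ S n * prodR (map snd ss) else 0)
    (words steps n))) (words (seq 0 N) (S n))).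

Lemma stop_term_eq N steps c i n :
  stop_term N steps c i n = stop_prob N steps c n (Z.of_nat (maxh c) + 1) i.
Proof.
  unfold stop_term, stop_prob; rewrite <- (map_id (flat_map _ _)), sumR_flat_map.
  apply sumR_map_ext; intros xs _; rewrite map_id; easy.
Qed.

(** Probability that a uniform column is lower than [z], that is, that an explorer at height [z]
    goes on. *)
Definition survival (N : nat) (c : config) (z : Z) : R :=
  / INR N * sumR (map (fun x => if Z.ltb (Z.of_nat (height c x)) z then 1 else 0) (seq 0 N)).

Lemma stop_prob_0 N steps c z i : (i < N)%nat ->
  stop_prob N steps c 0 z i = if Z.leb z (Z.of_nat (height c i)) then / INR N else 0.
Proof.
  intros Hi; unfold stop_prob; rewrite sumR_words_S; simpl words.
  cbn [map sumR fold_right]; rewrite Rplus_0_r.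
  rewrite (sumR_single _ _ i).
  - simpl; rewrite Nat.eqb_refl, Bool.andb_true_r; destruct (Z.leb _ _); ring.
  - apply seq_NoDup.
  - apply in_seq; lia.
  - intros x _ Hx; simpl; destruct (Nat.eqb_spec x i); [easy|].
    rewrite Bool.andb_false_r; ring.
Qed.

(** First-step decomposition: the first column must be lower than [z], and the first increment is
    independent of it. *)
Lemma stop_prob_S N steps c n z i :
  stop_prob N steps c (S n) z i =
  survival N c z * sumR (map (fun s => snd s * stop_prob N steps c n (z + fst s) i) steps).
Proof.
  unfold stop_prob at 1; rewrite sumR_words_S.
  set (k := fun xs => sumR (map (fun ss => sumR (map (fun s : Z * R => snd s *
    (if stops_at c i (z + fst s) xs ss then (/ INR N) ^ S n * prodR (map snd ss) else 0))
    steps)) (words steps n))).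
  transitivity (sumR (map (fun xs => survival N c z * k xs) (words (seq 0 N) (S n)))).
  - apply sumR_map_ext; intros xs _; unfold survival.
    rewrite Rmult_assoc, (Rmult_comm (sumR _)), <- Rmult_assoc, <- sumR_scal.
    apply sumR_map_ext; intros x _; rewrite sumR_words_S; unfold k.
    destruct (Z.ltb_spec (Z.of_nat (height c x)) z) as [Hz | Hz].
    + rewrite Rmult_1_r, <- sumR_scal; apply sumR_map_ext; intros ss _.
      rewrite <- sumR_scal; apply sumR_map_ext; intros s _.
      rewrite stops_at_cons; apply Z.ltb_lt in Hz; rewrite Hz; simpl.
      destruct (stops_at c i (z + fst s) xs ss); ring.
    + rewrite Rmult_0_r, (sumR_map_ext _ (fun _ => 0)); [rewrite sumR_const; ring|].
      intros ss _; rewrite (sumR_map_ext _ (fun _ => 0)); [rewrite sumR_const; ring|].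
      intros s _; rewrite stops_at_cons; apply Z.ltb_ge in Hz; rewrite Hz; easy.
  - rewrite sumR_scal; f_equal; unfold k.
    rewrite (sumR_map_ext _ (fun xs => sumR (map (fun s : Z * R => snd s *
      sumR (map (fun ss => if stops_at c i (z + fst s) xs ss
        then (/ INR N) ^ S n * prodR (map snd ss) else 0) (words steps n))) steps))).
    + rewrite sumR_swap; apply sumR_map_ext; intros s _; rewrite sumR_scal; easy.
    + intros xs _; rewrite sumR_swap; apply sumR_map_ext; intros s _; apply sumR_scal.
Qed.

Lemma height_le_maxh c i : (height c i <= maxh c)%nat.
Proof.
  unfold height, maxh; revert i; induction c as [|a c IH]; intros [|i]; simpl; try lia.
  specialize (IH i); lia.
Qed.

Lemma survival_bounds N c z : 0 <= survival N c z <= 1.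
Proof.
  unfold survival; set (g := fun x => _).
  assert (H0 : 0 <= / INR N).
  (* For [N = 0] the convention [/ 0 = 0] applies. *)
  { destruct N; [simpl; rewrite Rinv_0; lra|].
    apply Rlt_le, Rinv_0_lt_compat, lt_0_INR; lia. }
  split.
  - apply Rmult_le_pos; [easy|]; apply sumR_nonneg; intros x _; unfold g.
    destruct (Z.ltb _ _); lra.
  - assert (H : sumR (map g (seq 0 N)) <= sumR (map (fun _ => 1) (seq 0 N))).
    { apply sumR_le; intros x _; unfold g; destruct (Z.ltb _ _); lra. }
    rewrite sumR_const, length_seq, Rmult_1_r in H.
    apply (Rmult_le_compat_l _ _ _ H0) in H.
    destruct N; [simpl in *; lra|].
    rewrite Rinv_l in H; [easy|]; apply not_0_INR; easy.
Qed.

(** No column is lower than [0], so an explorer at height [0] stops at once; this is the boundary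
    condition of the arguments below. *)
Lemma survival_le_0 N c z : (z <= 0)%Z -> survival N c z = 0.
Proof.
  intros Hz; unfold survival; rewrite (sumR_map_ext _ (fun _ => 0)).
  - rewrite sumR_const; ring.
  - intros x _; destruct (Z.ltb_spec (Z.of_nat (height c x)) z); [lia | easy].
Qed.

(** * Limits of real sequences, bounded subharmonic sequences and monotone averages *)

Lemma sumR_term_le {A : Type} (f : A -> R) (l : list A) (a : A) :
  (forall b, In b l -> 0 <= f b) -> In a l -> f a <= sumR (map f l).
Proof.
  induction l as [|b l IH]; simpl; intros Hf Hin; [easy|].
  pose proof (Hf b (or_introl eq_refl)).
  assert (0 <= sumR (map f l)) by (apply sumR_nonneg; auto).
  destruct Hin as [-> | Hin]; [lra|].
  assert (f a <= sumR (map f l)) by auto; lra.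
Qed.

Lemma sum_f_R0_S_l (f : nat -> R) (n : nat) :
  sum_f_R0 f (S n) = f 0%nat + sum_f_R0 (fun m => f (S m)) n.
Proof. rewrite decomp_sum by lia; easy. Qed.

Lemma Un_cv_sumR {A : Type} (u : A -> nat -> R) (q : A -> R) (l : list A) :
  (forall a, In a l -> Un_cv (u a) (q a)) ->
  Un_cv (fun n => sumR (map (fun a => u a n) l)) (sumR (map q l)).
Proof.
  induction l as [|a l IH]; intros H; simpl.
  - intros eps Heps; exists 0%nat; intros; unfold Rdist; rewrite Rminus_diag, Rabs_R0; easy.
  - apply (CV_plus (u a)); [apply H; simpl; auto | apply IH; intros; apply H; simpl; auto].
Qed.

Lemma Un_cv_le (u v : nat -> R) (a b : R) :
  (forall n, u n <= v n) -> Un_cv u a -> Un_cv v b -> a <= b.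
Proof.
  intros H Hu Hv; destruct (Rle_lt_dec a b) as [|Hab]; [easy|exfalso].
  destruct (Hu ((a - b) / 2)) as [n1 H1]; [lra|].
  destruct (Hv ((a - b) / 2)) as [n2 H2]; [lra|].
  specialize (H1 (max n1 n2) ltac:(lia)); specialize (H2 (max n1 n2) ltac:(lia)).
  specialize (H (max n1 n2)); unfold Rdist in *.
  apply Rabs_def2 in H1, H2; lra.
Qed.

Lemma Un_cv_const (a : R) : Un_cv (fun _ => a) a.
Proof. intros eps Heps; exists 0%nat; intros; rewrite Rdist_eq; easy. Qed.

Lemma Un_cv_scal (k : R) (u : nat -> R) (a : R) : Un_cv u a -> Un_cv (fun n => k * u n) (k * a).
Proof. intros H; apply (CV_mult (fun _ => k)); [apply Un_cv_const | exact H]. Qed.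

(* The increments of a positive part would be nondecreasing, hence [f] unbounded. *)
Lemma bounded_subharmonic_le_0 (f : nat -> R) (alpha C : R) :
  0 <= alpha <= / 2 -> f 0%nat = 0 -> (forall k, f k <= C) ->
  (forall k, f (S k) <= alpha * f (S (S k)) + (1 - alpha) * f k) -> forall k, f k <= 0.
Proof.
  intros Ha H0 HC Hsub.
  assert (Hinc : forall k, f (S k) - f k <= 0).
  { intros k; destruct (Rle_lt_dec (f (S k) - f k) 0) as [|Hd]; [easy|exfalso].
    set (d := f (S k) - f k) in *.
    assert (Hgrow : forall n, d <= f (S (n + k)) - f (n + k)%nat).
    { induction n as [|n IH]; [unfold d; simpl; lra|].
      specialize (Hsub (n + k)%nat); cbn [Nat.add].
      set (e := f (S (n + k)) - f (n + k)%nat) in *.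
      set (e' := f (S (S (n + k))) - f (S (n + k))).
      (* Subharmonicity in terms of consecutive increments [e] and [e']; [alpha <= / 2] makes the
         left side nonnegative. *)
      assert (He : (1 - 2 * alpha) * e <= alpha * (e' - e)) by (unfold e, e'; lra).
      destruct (Rle_lt_dec e e') as [|Hlt]; [lra|exfalso].
      destruct (Req_dec alpha 0) as [Ha0 | Ha0]; [rewrite Ha0 in He; lra|].
      assert (0 < alpha * (e - e')) by (apply Rmult_lt_0_compat; lra).
      assert (0 <= (1 - 2 * alpha) * e) by (apply Rmult_le_pos; lra).
      lra. }
    assert (Hlin : forall n, f k + INR n * d <= f (n + k)%nat).
    { induction n as [|n IH]; [simpl; lra|].
      specialize (Hgrow n); rewrite S_INR; cbn [Nat.add]; lra. }
    (* After this many steps the linear lower bound exceeds [C]. *)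
    destruct (INR_unbounded ((C - f k) / d)) as [n Hn].
    specialize (Hlin n); specialize (HC (n + k)%nat).
    apply (Rmult_lt_compat_r d) in Hn; [|easy].
    unfold Rdiv in Hn; rewrite Rmult_assoc, Rinv_l in Hn; lra. }
  induction k as [|k IH]; [lra|]; specialize (Hinc k); lra.
Qed.

(** Each term added after index [b] is at least [g b], hence at least the average up to [b].
    Averages are compared by cross-multiplication. *)
Lemma average_mono (g : nat -> R) (m b a : nat) : (b <= a <= m)%nat ->
  (forall k, (k < m)%nat -> g k <= g (S k)) ->
  sumR (map g (seq 0 (S b))) * INR (S a) <= sumR (map g (seq 0 (S a))) * INR (S b).
Proof.
  intros [Hba Ham] Hg.
  assert (Hmono : forall j k, (j <= k)%nat -> (k <= m)%nat -> g j <= g k).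
  { intros j k Hjk; induction Hjk as [|k Hjk IH]; intros Hk; [lra|].
    specialize (IH ltac:(lia)); specialize (Hg k ltac:(lia)); lra. }
  assert (Hb : sumR (map g (seq 0 (S b))) <= INR (S b) * g b).
  { rewrite <- (length_seq (S b) 0) at 2; rewrite <- (sumR_const (g b)).
    apply sumR_le; intros k Hk; apply in_seq in Hk; apply Hmono; lia. }
  induction Hba as [|a Hba IH]; [lra|].
  specialize (IH ltac:(lia)).
  rewrite (seq_S (S a) 0), map_app, sumR_app; cbn [map sumR fold_right].
  rewrite (S_INR (S a)); specialize (Hmono b (S a) ltac:(lia) Ham).
  pose proof (pos_INR (S b)).
  apply (Rmult_le_compat_l (INR (S b))) in Hmono; [|easy].
  replace (0 + S a)%nat with (S a) by lia; nra.
Qed.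

(** * The landing law of an explorer going up with probability [alpha] and down otherwise *)

Section Landing.
Variables (N : nat) (c : config) (steps : list (Z * R)) (alpha : R).
Hypothesis N_pos : (0 < N)%nat.
Hypothesis alpha_bounds : 0 <= alpha <= / 2.
(** The increment law is given through expectations of test functions, so that step lists of
    different lengths are treated alike. *)
Hypothesis steps_mean : forall f : Z -> R,
  sumR (map (fun s => snd s * f (fst s)) steps) = alpha * f 1%Z + (1 - alpha) * f (-1)%Z.

Let s := survival N c.
Let T := stop_prob N steps c.

Lemma stop_prob_step n z i :
  T (S n) z i = s z * (alpha * T n (z + 1)%Z i + (1 - alpha) * T n (z - 1)%Z i).
Proof.
  unfold T; rewrite stop_prob_S; f_equal.
  apply (steps_mean (fun d => stop_prob N steps c n (z + d) i)).
Qed.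

Lemma inv_N_pos : 0 < / INR N.
Proof. apply Rinv_0_lt_compat, lt_0_INR; easy. Qed.

Lemma stop_prob_nonneg n z i : (i < N)%nat -> 0 <= T n z i.
Proof.
  intros Hi; revert z; induction n as [|n IH]; intros z.
  - unfold T; rewrite stop_prob_0 by easy; pose proof inv_N_pos; destruct (Z.leb _ _); lra.
  - rewrite stop_prob_step.
    pose proof (IH (z + 1)%Z); pose proof (IH (z - 1)%Z).
    apply Rmult_le_pos; [apply survival_bounds|].
    apply Rplus_le_le_0_compat; apply Rmult_le_pos; lra.
Qed.

(** Probability that an explorer started at [z] has stopped by time [n]. *)
Definition stopped (n : nat) (z : Z) : R :=
  sumR (map (fun i => sum_f_R0 (fun m => T m z i) n) (seq 0 N)).

Lemma stopped_0 z : stopped 0 z = 1 - s z.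
Proof.
  unfold stopped, s, survival; simpl.
  assert (E : sumR (map (fun i => T 0 z i) (seq 0 N)) =
    sumR (map (fun i => / INR N * (1 + -1 * (if Z.ltb (Z.of_nat (height c i)) z then 1 else 0)))
      (seq 0 N))).
  { apply sumR_map_ext; intros i Hi; apply in_seq in Hi; unfold T; rewrite stop_prob_0 by lia.
    destruct (Z.leb_spec z (Z.of_nat (height c i))), (Z.ltb_spec (Z.of_nat (height c i)) z);
      try lia; ring. }
  rewrite E, sumR_scal, sumR_plus, sumR_const, length_seq, sumR_scal.
  field; apply not_0_INR; lia.
Qed.

Lemma stopped_S n z :
  stopped (S n) z =
  1 - s z + s z * (alpha * stopped n (z + 1) + (1 - alpha) * stopped n (z - 1)).
Proof.
  rewrite <- stopped_0; unfold stopped.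
  rewrite <- !(sumR_scal (A := nat)), <- sumR_plus, <- sumR_scal, <- sumR_plus.
  apply sumR_map_ext; intros i _; rewrite sum_f_R0_S_l; simpl; f_equal.
  rewrite !scal_sum, <- plus_sum, scal_sum; apply sum_eq; intros m _.
  rewrite stop_prob_step; ring.
Qed.

Lemma stopped_le_1 n z : stopped n z <= 1.
Proof.
  revert z; induction n as [|n IH]; intros z; pose proof (survival_bounds N c z) as Hs;
    fold s in Hs; [rewrite stopped_0; lra|].
  rewrite stopped_S; pose proof (IH (z + 1)%Z); pose proof (IH (z - 1)%Z).
  assert (alpha * stopped n (z + 1) + (1 - alpha) * stopped n (z - 1) <= 1) by nra; nra.
Qed.

Lemma stopped_growing z : Un_growing (fun n => stopped n z).
Proof.
  intros n; apply sumR_le; intros i Hi; apply in_seq in Hi; simpl.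
  pose proof (stop_prob_nonneg (S n) z i ltac:(lia)); lra.
Qed.

(** The explorer stops almost surely: the probability of never stopping, as a function of the
    starting height, is bounded, subharmonic and zero at height [0], hence zero. *)
Lemma stopped_cv_1 (k : nat) : Un_cv (fun n => stopped n (Z.of_nat k)) 1.
Proof.
  assert (Hex : forall z, exists l, Un_cv (fun n => stopped n z) l).
  { intros z; destruct (growing_cv _ (stopped_growing z)) as [l Hl]; [|eauto].
    exists 1; intros r [n ->]; apply stopped_le_1. }
  destruct (functional_choice _ Hex) as [l Hl]; clear Hex.
  (* The first-step equation passes to the limit. *)
  assert (Heq : forall z, l z = 1 - s z + s z * (alpha * l (z + 1)%Z + (1 - alpha) * l (z - 1)%Z)).
  { intros z; apply (UL_sequence (fun n => stopped (S n) z)).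
    - intros eps Heps; destruct (Hl z eps Heps) as [n0 Hn0]; exists n0; intros; apply Hn0; lia.
    - apply (Un_cv_ext (fun n => 1 - s z + s z *
        (alpha * stopped n (z + 1) + (1 - alpha) * stopped n (z - 1)))).
      { intros n; symmetry; apply stopped_S. }
      apply (CV_plus (fun _ => 1 - s z)); [apply Un_cv_const|].
      apply Un_cv_scal, (CV_plus (fun n => alpha * _)); apply Un_cv_scal, Hl. }
  assert (Hle : forall z, l z <= 1).
  { intros z; apply (Un_cv_le (fun n => stopped n z) (fun _ => 1));
      [intros; apply stopped_le_1 | apply Hl | apply Un_cv_const]. }
  assert (H0 : forall z, 0 <= l z).
  { intros z; apply (Un_cv_le (fun _ => 0) (fun n => stopped n z)); auto using Un_cv_const.
    intros n; apply sumR_nonneg; intros i Hi; apply in_seq in Hi.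
    apply cond_pos_sum; intros m; apply stop_prob_nonneg; lia. }
  assert (Hf : 1 - l (Z.of_nat k) <= 0).
  { apply (bounded_subharmonic_le_0 (fun k => 1 - l (Z.of_nat k)) alpha 1); auto.
    - rewrite Heq; unfold s; rewrite survival_le_0 by (simpl; lia); ring.
    - intros j; specialize (H0 (Z.of_nat j)); lra.
    - intros j; rewrite (Heq (Z.of_nat (S j))).
      pose proof (survival_bounds N c (Z.of_nat (S j))) as Hs; fold s in Hs.
      replace (Z.of_nat (S j) + 1)%Z with (Z.of_nat (S (S j))) by lia.
      replace (Z.of_nat (S j) - 1)%Z with (Z.of_nat j) by lia.
      pose proof (Hle (Z.of_nat (S (S j)))); pose proof (Hle (Z.of_nat j)).
      assert (0 <= alpha * (1 - l (Z.of_nat (S (S j)))) + (1 - alpha) * (1 - l (Z.of_nat j)))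
        by nra.
      nra. }
  replace 1 with (l (Z.of_nat k)); [apply Hl|].
  specialize (Hle (Z.of_nat k)); lra.
Qed.

(** Probability to be at height [y] at time [n] without having stopped before. *)
Fixpoint visit (n : nat) (z y : Z) : R :=
  match n with
  | O => if Z.eqb z y then 1 else 0
  | S n' => s z * (alpha * visit n' (z + 1) y + (1 - alpha) * visit n' (z - 1) y)
  end.

Lemma visit_nonneg n z y : 0 <= visit n z y.
Proof.
  revert z; induction n as [|n IH]; intros z; simpl; [destruct (Z.eqb z y); lra|].
  pose proof (IH (z + 1)%Z); pose proof (IH (z - 1)%Z).
  apply Rmult_le_pos; [apply survival_bounds|].
  apply Rplus_le_le_0_compat; apply Rmult_le_pos; lra.
Qed.

(** [visit] recurses on the first step; decomposing at the last step lets [y] vary while the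
    starting height stays fixed. *)
Lemma visit_last n z y :
  visit (S n) z y = alpha * (s (y - 1) * visit n z (y - 1)) +
                    (1 - alpha) * (s (y + 1) * visit n z (y + 1)).
Proof.
  revert z; induction n as [|n IH]; intros z.
  - simpl.
    destruct (Z.eqb_spec (z + 1) y), (Z.eqb_spec (z - 1) y),
      (Z.eqb_spec z (y - 1)), (Z.eqb_spec z (y + 1)); try lia; subst;
      try replace (z + 1 - 1)%Z with z by lia; try replace (z - 1 + 1)%Z with z by lia; ring.
  - change (visit (S (S n)) z y) with
      (s z * (alpha * visit (S n) (z + 1) y + (1 - alpha) * visit (S n) (z - 1) y)).
    rewrite !IH; simpl; ring.
Qed.

(** Stopping in column [i] at time [n] means being at a height between 0 and that of the column and
    drawing [i] among [N]; heights below 0 are never visited. *)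
Lemma stop_prob_visit n z i : (i < N)%nat -> (0 <= z)%Z ->
  T n z i = / INR N * sumR (map (fun y => visit n z (Z.of_nat y)) (seq 0 (S (height c i)))).
Proof.
  intros Hi; revert z; induction n as [|n IH]; intros z Hz.
  - unfold T; rewrite stop_prob_0 by easy; cbn [visit].
    destruct (Z.leb_spec z (Z.of_nat (height c i))) as [H | H].
    + rewrite (sumR_single _ _ (Z.to_nat z)).
      * rewrite Z2Nat.id, Z.eqb_refl by lia; ring.
      * apply seq_NoDup.
      * apply in_seq; lia.
      * intros y _ Hy; destruct (Z.eqb_spec z (Z.of_nat y)); [lia | easy].
    + rewrite (sumR_map_ext _ (fun _ => 0)); [rewrite sumR_const; ring|].
      intros y Hy; apply in_seq in Hy; destruct (Z.eqb_spec z (Z.of_nat y)); [lia | easy].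
  - rewrite stop_prob_step; cbn [visit].
    rewrite sumR_scal, sumR_plus, !sumR_scal.
    (* At [z = 0] the survival factor kills both sides; otherwise [z - 1] is still nonnegative. *)
    destruct (Z.eq_dec z 0) as [-> | Hz0].
    + unfold s; rewrite survival_le_0 by lia; ring.
    + rewrite !IH by lia; ring.
Qed.

(** * The Green function below the starting height *)

Let z0 := (Z.of_nat (maxh c) + 1)%Z.

(** Expected number of visits to [y] up to time [n]; the truncation keeps every comparison between
    finite sums. *)
Definition green (n : nat) (y : Z) : R := sum_f_R0 (fun m => visit m z0 y) n.

Lemma green_nonneg n y : 0 <= green n y.
Proof. apply cond_pos_sum; intros; apply visit_nonneg. Qed.

Lemma green_S n y : y <> z0 ->
  green (S n) y = alpha * (s (y - 1) * green n (y - 1)) + (1 - alpha) * (s (y + 1) * green n (y + 1)).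
Proof.
  intros Hy; unfold green; rewrite sum_f_R0_S_l.
  replace (visit 0 z0 y) with 0 by (simpl; destruct (Z.eqb_spec z0 y); [lia | easy]).
  rewrite Rplus_0_l.
  rewrite !scal_sum, <- plus_sum; apply sum_eq; intros m _.
  rewrite visit_last; ring.
Qed.

(* Below [z0] the surviving part [s * green n] is subharmonic, because
   [s * green n <= green n <= green (S n)]; it vanishes at 0, so it increases. *)
Lemma surviving_green_mono n k : (Z.of_nat k < z0)%Z ->
  s (Z.of_nat k) * green n (Z.of_nat k) <= s (Z.of_nat k + 1) * green n (Z.of_nat k + 1).
Proof.
  induction k as [|k IH]; intros Hk.
  - unfold s at 1; rewrite survival_le_0 by (simpl; lia); rewrite Rmult_0_l.
    apply Rmult_le_pos; [apply survival_bounds | apply green_nonneg].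
  - specialize (IH ltac:(lia)).
    replace (Z.of_nat (S k)) with (Z.of_nat k + 1)%Z in * by lia.
    set (y := (Z.of_nat k + 1)%Z) in *.
    assert (H1 : s y * green n y <= green n y).
    { pose proof (survival_bounds N c y) as Hs; fold s in Hs; pose proof (green_nonneg n y); nra. }
    assert (H2 : green n y <= green (S n) y).
    { unfold green; cbn [sum_f_R0]; pose proof (visit_nonneg (S n) z0 y); lra. }
    rewrite green_S in H2 by lia.
    replace (y - 1)%Z with (Z.of_nat k) in H2 by lia.
    (* With g = s * green n, the bounds give g(y) <= alpha g(y - 1) + (1 - alpha) g(y + 1), and g(y
       - 1) <= g(y) by induction; then divide by 1 - alpha > 0. *)
    nra.
Qed.

(** By [green_S] both sides are the same average of the surviving part, at neighbours shifted by
    one, and that part increases. *)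
Lemma green_mono n k : (k < maxh c)%nat -> green n (Z.of_nat k) <= green n (Z.of_nat (S k)).
Proof.
  intros Hk; destruct n as [|n].
  - unfold green; simpl; destruct (Z.eqb_spec z0 (Z.of_nat k)); [lia|].
    destruct (Z.eqb z0 _); lra.
  - rewrite !green_S by lia.
    replace (Z.of_nat (S k) - 1)%Z with (Z.of_nat k) by lia.
    pose proof (surviving_green_mono n (S k) ltac:(lia)) as H1.
    replace (Z.of_nat (S k)) with (Z.of_nat k + 1)%Z in * by lia.
    assert (H2 : s (Z.of_nat k - 1) * green n (Z.of_nat k - 1) <= s (Z.of_nat k) * green n (Z.of_nat k)).
    { destruct k as [|k].
      - unfold s at 1; rewrite survival_le_0 by (simpl; lia); rewrite Rmult_0_l.
        apply Rmult_le_pos; [apply survival_bounds | apply green_nonneg].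
      - pose proof (surviving_green_mono n k ltac:(lia)) as H.
        replace (Z.of_nat (S k) - 1)%Z with (Z.of_nat k) by lia.
        replace (Z.of_nat k + 1)%Z with (Z.of_nat (S k)) in H by lia; exact H. }
    nra.
Qed.

Lemma partial_stop_term n i : (i < N)%nat ->
  sum_f_R0 (stop_term N steps c i) n =
  / INR N * sumR (map (fun y => green n (Z.of_nat y)) (seq 0 (S (height c i)))).
Proof.
  intros Hi; induction n as [|n IH].
  - cbn [sum_f_R0]; rewrite stop_term_eq; apply stop_prob_visit; lia.
  - cbn [sum_f_R0]; rewrite IH, stop_term_eq.
    fold (T (S n) z0 i); rewrite stop_prob_visit, <- Rmult_plus_distr_l, <- sumR_plus by lia.
    easy.
Qed.

(** Partial sums increase and are bounded by [stopped], whose limit 1 is the total mass. The ratio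
    inequality is [average_mono] for the truncated Green function, passed to the limit. *)
Lemma landing_law : exists q : nat -> R,
  (forall i, (i < N)%nat -> land_prob N steps c i (q i) /\ 0 <= q i) /\
  sumR (map q (seq 0 N)) = 1 /\
  (forall i j, (i < N)%nat -> (j < N)%nat -> (height c j <= height c i)%nat ->
    q j * (INR (height c i) + 1) <= q i * (INR (height c j) + 1)).
Proof.
  assert (Hnn : forall i n, (i < N)%nat -> 0 <= stop_term N steps c i n).
  { intros i n Hi; rewrite stop_term_eq; apply stop_prob_nonneg; easy. }
  assert (Hex : forall i, exists q, (i < N)%nat -> land_prob N steps c i q).
  { intros i; destruct (lt_dec i N) as [Hi | Hi]; [|exists 0; easy].
    destruct (growing_cv (sum_f_R0 (stop_term N steps c i))) as [q Hq].
    - intros n; simpl; specialize (Hnn i (S n) Hi); lra.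
    - exists 1; intros r [n ->].
      apply Rle_trans with (stopped n z0); [|apply stopped_le_1].
      rewrite (sum_eq _ (fun m => T m z0 i)) by (intros; apply stop_term_eq).
      apply (sumR_term_le (fun i => sum_f_R0 (fun m => T m z0 i) n)); [|apply in_seq; lia].
      intros j Hj; apply in_seq in Hj; apply cond_pos_sum; intros; apply stop_prob_nonneg; lia.
    - exists q; intros _; exact Hq. }
  destruct (functional_choice _ Hex) as [q Hq]; clear Hex.
  exists q; repeat split.
  - auto.
  - apply (Un_cv_le (fun _ => 0) (sum_f_R0 (stop_term N steps c i))); auto using Un_cv_const.
    + intros n; apply cond_pos_sum; auto.
    + apply Hq; easy.
  - apply (UL_sequence (fun n => stopped n z0)).
    + apply Un_cv_sumR; intros i Hi; apply in_seq in Hi.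
      apply (Un_cv_ext (sum_f_R0 (stop_term N steps c i))); [|apply Hq; lia].
      intros n; apply sum_eq; intros; apply stop_term_eq.
    + unfold z0; replace (Z.of_nat (maxh c) + 1)%Z with (Z.of_nat (S (maxh c))) by lia.
      apply stopped_cv_1.
  - intros i j Hi Hj Hh.
    rewrite <- !S_INR, !(Rmult_comm (q _)).
    apply (Un_cv_le (fun n => INR (S (height c i)) * sum_f_R0 (stop_term N steps c j) n)
                    (fun n => INR (S (height c j)) * sum_f_R0 (stop_term N steps c i) n)).
    + intros n; rewrite !partial_stop_term by easy.
      pose proof (average_mono (fun y => green n (Z.of_nat y)) (maxh c) (height c j) (height c i)
        (conj Hh (height_le_maxh c i)) (green_mono n)) as H.
      pose proof inv_N_pos as HN; apply (Rmult_le_compat_l (/ INR N)) in H; lra.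
    + apply Un_cv_scal, Hq; easy.
    + apply Un_cv_scal, Hq; easy.
Qed.
End Landing.

(** * Comparison of the models *)

Lemma diffusive_steps_mean (f : Z -> R) :
  sumR (map (fun s => snd s * f (fst s)) diffusive_steps) = / 2 * f 1%Z + (1 - / 2) * f (-1)%Z.
Proof. simpl; lra. Qed.

Lemma ballistic_steps_mean (f : Z -> R) :
  sumR (map (fun s => snd s * f (fst s)) ballistic_steps) = 0 * f 1%Z + (1 - 0) * f (-1)%Z.
Proof. simpl; lra. Qed.

(** When f / g decreases along [l], the prefix has a larger share of [f] than of [g]: the pairwise
    inequality is summed over prefix times suffix, and the prefix times prefix terms cancel. *)
Lemma prefix_mass_ratio (f g : nat -> R) (l : list nat) (k : nat) :
  StronglySorted (fun i j => f j * g i <= f i * g j) l ->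
  sumR (map f l) * prefix_mass g l k <= prefix_mass f l k * sumR (map g l).
Proof.
  intros Hs.
  assert (Hcross : sumR (map f (skipn k l)) * prefix_mass g l k <=
                   prefix_mass f l k * sumR (map g (skipn k l))).
  { unfold prefix_mass; revert k; induction Hs as [|a l Hs IH Ha]; intros [|k]; simpl; try lra.
    rewrite Forall_forall in Ha; specialize (IH k).
    assert (sumR (map f (skipn k l)) * g a <= f a * sumR (map g (skipn k l))); [|lra].
    rewrite Rmult_comm, <- !sumR_scal; apply sumR_le; intros b Hb.
    assert (Hin : In b l) by (rewrite <- (firstn_skipn k l); apply in_or_app; auto).
    specialize (Ha b Hin); simpl in Ha; lra. }
  assert (E : forall h : nat -> R, sumR (map h l) = prefix_mass h l k + sumR (map h (skipn k l))).
  { intros h; unfold prefix_mass; rewrite <- sumR_app, <- map_app, firstn_skipn; easy. }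
  rewrite !E; lra.
Qed.

Definition polya_prob (N : nat) (c : config) (i : nat) : R :=
  (INR (height c i) + 1) / (INR (size c) + INR N).

Lemma sumR_heights (c : config) (l : list nat) :
  sumR (map (fun i => INR (height c i) + 1) l) =
  INR (list_sum (map (height c) l)) + INR (length l).
Proof.
  induction l as [|i l IH]; [simpl; lra|].
  cbn [map sumR fold_right length list_sum] in *; unfold sumR, list_sum in *.
  rewrite IH, plus_INR, S_INR; lra.
Qed.

Lemma ranking_size c pi : ranking c pi -> list_sum (map (height c) pi) = size c.
Proof.
  intros H; destruct (ranking_heights c pi H) as [Hp _].
  rewrite <- (excess_0 c), <- (excess_perm 0 _ _ Hp); symmetry; apply excess_0.
Qed.

Lemma prefix_mass_polya N c pi k : (0 < N)%nat ->
  prefix_mass (polya_prob N c) pi k =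
  prefix_mass (fun i => INR (height c i) + 1) pi k / (INR (size c) + INR N).
Proof.
  intros HN; unfold prefix_mass, polya_prob, Rdiv.
  rewrite Rmult_comm, <- sumR_scal; apply sumR_map_ext; intros; ring.
Qed.

Lemma sumR_heights_ranking c pi : ranking c pi ->
  sumR (map (fun i => INR (height c i) + 1) pi) = INR (size c) + INR (length c).
Proof.
  intros H; rewrite sumR_heights, (ranking_size c pi H), (ranking_length c pi H); easy.
Qed.

Lemma total_pos N (c : config) : (0 < N)%nat -> 0 < INR (size c) + INR N.
Proof. intros H; pose proof (pos_INR (size c)); apply lt_0_INR in H; lra. Qed.

Lemma polya_law N : (0 < N)%nat ->
  is_law N (fun c i q => q = (INR (height c i) + 1) / (INR (size c) + INR N)) (polya_prob N).
Proof.
  intros HN c Hc; pose proof (total_pos N c HN) as Hpos; repeat split; auto.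
  - intros i _; apply Rmult_le_pos; [pose proof (pos_INR (height c i)); lra|].
    apply Rlt_le, Rinv_0_lt_compat, Hpos.
  - destruct (ranking_exists c) as [pi Hpi].
    rewrite <- Hc at 2; rewrite <- (sumR_perm _ _ _ (proj1 Hpi)).
    rewrite <- (prefix_mass_all _ _ (length pi)), prefix_mass_polya, prefix_mass_all by auto.
    rewrite (sumR_heights_ranking c pi Hpi), Hc; field; lra.
Qed.

Lemma alloc_law N : (0 < N)%nat -> is_law N (fun _ _ q => q = / INR N) (fun _ _ => / INR N).
Proof.
  intros HN c _; assert (0 < INR N) by (apply lt_0_INR; easy); repeat split; auto.
  - intros i _; apply Rlt_le, Rinv_0_lt_compat; easy.
  - rewrite sumR_const, length_seq; field; lra.
Qed.

(** The mass of the top [k] ranks is their total height plus [k], over a denominator common to both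
    configurations. *)
Lemma polya_mass_le N c d pi rho k : (0 < N)%nat -> length c = N -> length d = N ->
  dominates c d -> ranking c pi -> ranking d rho -> (k <= N)%nat ->
  prefix_mass (polya_prob N d) rho k <= prefix_mass (polya_prob N c) pi k.
Proof.
  intros HN Hc Hd Hdom Hpi Hrho Hk.
  rewrite !prefix_mass_polya by easy; rewrite (proj1 Hdom).
  apply Rmult_le_compat_r; [apply Rlt_le, Rinv_0_lt_compat, total_pos, HN|].
  unfold prefix_mass; rewrite !sumR_heights, !length_firstn.
  rewrite (ranking_length c pi Hpi), (ranking_length d rho Hrho), Hc, Hd.
  apply Rplus_le_compat_r, le_INR; rewrite <- !firstn_map.
  destruct (ranking_heights c pi Hpi), (ranking_heights d rho Hrho).
  apply (dominates_prefix c d); auto; lia.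
Qed.

(** Polya's law at [c] is the intermediate term: it has more top mass than Polya's law at [d] by
    domination, and less than deposition at [c] by the ratio inequality. *)
Lemma deposition_dominates_polya N steps alpha : (0 < N)%nat -> 0 <= alpha <= / 2 ->
  (forall f : Z -> R,
    sumR (map (fun s => snd s * f (fst s)) steps) = alpha * f 1%Z + (1 - alpha) * f (-1)%Z) ->
  dominating_coupling N (add_kernel N (land_prob N steps)) (polya_kernel N).
Proof.
  intros HN Ha Hsteps.
  destruct (functional_choice _ (fun c => landing_law N c steps alpha HN Ha Hsteps)) as [p Hp].
  apply (coupling_of_ranked_domination N _ _ p (polya_prob N)).
  - intros c Hc; destruct (Hp c) as (H1 & H2 & _); repeat split; auto.
    + intros i Hi; apply H1, Hi.
    + intros i r Hi Hr; apply (uniqueness_sum (stop_term N steps c i)); [exact Hr | apply H1, Hi].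
  - apply polya_law, HN.
  - intros c d pi rho k Hc Hd Hdom Hpi Hrho Hk.
    apply Rle_trans with (prefix_mass (polya_prob N c) pi k);
      [apply (polya_mass_le N c d); auto|].
    destruct (Hp c) as (_ & Htot & Hratio).
    rewrite prefix_mass_polya by easy.
    assert (H : sumR (map (p c) pi) * prefix_mass (fun i => INR (height c i) + 1) pi k <=
                prefix_mass (p c) pi k * sumR (map (fun i => INR (height c i) + 1) pi)).
    { apply prefix_mass_ratio.
      destruct Hpi as [Hperm Hs].
      assert (Hin : forall i, In i pi -> (i < N)%nat).
      { intros i Hi; apply (Permutation_in _ Hperm), in_seq in Hi; lia. }
      clear - Hs Hin Hratio; induction Hs as [|i l Hs IH Hi]; constructor.
      - apply IH; intros; apply Hin; simpl; auto.
      - rewrite Forall_forall in *; intros j Hj.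
        apply Hratio; [apply Hin; simpl; auto.. | apply Hi, Hj]. }
    rewrite (sumR_heights_ranking c pi Hpi), (sumR_perm _ _ _ (proj1 Hpi)), Hc, Htot in H.
    pose proof (total_pos N c HN) as Hpos.
    apply (Rmult_le_reg_r (INR (size c) + INR N)); [easy|].
    unfold Rdiv; rewrite Rmult_assoc, Rinv_l; lra.
Qed.

(** The weights [height + 1] decrease along a ranking, so their top share is at least the uniform
    share [k / N]. *)
Lemma polya_dominates_alloc N : (0 < N)%nat ->
  dominating_coupling N (polya_kernel N) (alloc_kernel N).
Proof.
  intros HN.
  apply (coupling_of_ranked_domination N _ _ (polya_prob N) (fun _ _ => / INR N)).
  - apply polya_law, HN.
  - apply alloc_law, HN.
  - intros c d pi rho k Hc Hd Hdom Hpi Hrho Hk.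
    pose proof (total_pos N c HN) as Hpos; assert (HN' : 0 < INR N) by (apply lt_0_INR, HN).
    pose proof (ranking_length _ _ Hpi) as Lc; pose proof (ranking_length _ _ Hrho) as Ld.
    rewrite prefix_mass_polya by easy.
    assert (H : sumR (map (fun i => INR (height c i) + 1) pi) * prefix_mass (fun _ => 1) pi k <=
                prefix_mass (fun i => INR (height c i) + 1) pi k * sumR (map (fun _ => 1) pi)).
    { apply prefix_mass_ratio; destruct Hpi as [_ Hs]; revert Hs; clear.
      induction 1 as [|i l Hs IH Hi]; constructor; auto.
      revert Hi; apply Forall_impl; intros j Hj; apply le_INR in Hj; lra. }
    rewrite (sumR_heights_ranking c pi Hpi), Hc in H.
    unfold prefix_mass in *; rewrite !sumR_const, length_firstn, Nat.min_l in * by lia.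
    rewrite Lc, Hc in H.
    apply (Rmult_le_reg_r (INR (size c) + INR N)); [easy|].
    unfold Rdiv; rewrite (Rmult_assoc (sumR _)), Rinv_l, Rmult_1_r by lra.
    apply (Rmult_le_reg_r (INR N)); [easy|].
    replace (INR k * / INR N * (INR (size c) + INR N) * INR N) with
      (INR k * (INR (size c) + INR N)) by (field; lra).
    lra.
Qed.

Theorem theorem1p3 (N : nat) (HN : (2 <= N)%nat) :
  (dominating_coupling N (diffusive_kernel N) (polya_kernel N) /\
   dominating_coupling N (ballistic_kernel N) (polya_kernel N)) /\
  dominating_coupling N (polya_kernel N) (alloc_kernel N).
Proof.
  assert (HN0 : (0 < N)%nat) by lia.
  repeat split.
  - apply (deposition_dominates_polya N diffusive_steps (/ 2) HN0); [lra|].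
    apply diffusive_steps_mean.
  (* Ballistic explorers never go up, hence [alpha = 0]. *)
  - apply (deposition_dominates_polya N ballistic_steps 0 HN0); [lra|].
    apply ballistic_steps_mean.
  - apply polya_dominates_alloc, HN0.
Qed.
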